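(* Given a split graph $G=(K\cup I,E)$ (as a list of vertices, with the partition, and a list of edges) and a weight function $w:V\to\mathbb{R}$, a feasible set $F$ of the split graph vertex shelling antimatroid of $G$ maximizing $w(F)=\sum_{f\in F}w(f)$ can be found in time polynomial in $|V|+|E|$.
   Context: A split graph $G=(K\cup I,E)$ is a finite simple graph whose vertex set $V=K\cup I$ comes with a fixed partition into a clique $K$ and an independent set $I$. A vertex is simplicial if its neighbours induce a clique. The split graph vertex shelling antimatroid of $G$ is $(V,\mathcal{F})$ where $F\subseteq V$ is feasible iff there is an ordering $f_1,\dots,f_{|F|}$ of $F$ such that each $f_j$ is simplicial in $G$ minus $\{f_1,\dots,f_{j-1}\}$ (the empty set is feasible). *)

(* Defs.v *)
From Stdlib Require Import Reals List Arith.
Import ListNotations.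
Open Scope R_scope.

(* Split graphs, given as: vertex count n (vertices 0..n-1), the        *)
(* partition as a boolean inK (true = clique side K, false = I), and    *)
(* an edge list E : list (nat*nat).                                     *)

Definition adj (E : list (nat * nat)) (u v : nat) : Prop :=
  In (u, v) E \/ In (v, u) E.

Definition is_split_graph (n : nat) (inK : nat -> bool) (E : list (nat * nat)) : Prop :=
  (forall u v, In (u, v) E -> (u < n)%nat /\ (v < n)%nat /\ u <> v) /\
  (forall u v, (u < n)%nat -> (v < n)%nat -> u <> v ->
     inK u = true -> inK v = true -> adj E u v) /\
  (forall u v, (u < n)%nat -> (v < n)%nat ->
     inK u = false -> inK v = false -> ~ adj E u v).

Definition simplicial_in (n : nat) (E : list (nat * nat)) (S : list nat) (v : nat) : Prop :=
  (v < n)%nat /\ ~ In v S /\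
  forall a b, (a < n)%nat -> (b < n)%nat -> ~ In a S -> ~ In b S -> a <> b ->
    adj E v a -> adj E v b -> adj E a b.

Fixpoint shelling_from (n : nat) (E : list (nat * nat)) (S : list nat) (s : list nat) : Prop :=
  match s with
  | [] => True
  | x :: s' => simplicial_in n E S x /\ shelling_from n E (x :: S) s'
  end.

Definition feasible (n : nat) (E : list (nat * nat)) (F : nat -> Prop) : Prop :=
  exists s, shelling_from n E [] s /\ forall v, In v s <-> F v.

(* w(F) along an ordering (orderings are duplicate-free) *)
Definition weight (w : nat -> R) (s : list nat) : R :=
  fold_right Rplus 0 (map w s).

Definition max_weight_feasible (n : nat) (E : list (nat * nat)) (w : nat -> R)
    (F : nat -> Prop) : Prop :=
  exists s, shelling_from n E [] s /\ (forall v, In v s <-> F v) /\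
    forall s', shelling_from n E [] s' -> weight w s' <= weight w s.

(* Machine model: a unit-cost RAM with nat registers (addition,         *)
(* truncated subtraction, indirect addressing) and real registers       *)
(* (real RAM: +, -, comparison), a read-only input (nat tape In and     *)
(* real tape W) and a write-only output memory Out.  Every executed     *)
(* instruction costs one step.                                          *)

Inductive instr : Type :=
| NConst (d c : nat)          (* N[d] := c *)
| NAdd (d a b : nat)          (* N[d] := N[a] + N[b] *)
| NSub (d a b : nat)          (* N[d] := N[a] - N[b] (truncated) *)
| NLoad (d a : nat)           (* N[d] := N[N[a]] *)
| NStore (a s : nat)          (* N[N[a]] := N[s] *)
| NIn (d a : nat)             (* N[d] := In[N[a]] *)
| RZero (d : nat)             (* Rr[d] := 0 *)
| RAdd (d a b : nat)          (* Rr[d] := Rr[a] + Rr[b] *)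
| RSub (d a b : nat)          (* Rr[d] := Rr[a] - Rr[b] *)
| RLoad (d a : nat)           (* Rr[d] := Rr[N[a]] *)
| RStore (a s : nat)          (* Rr[N[a]] := Rr[s] *)
| RIn (d a : nat)             (* Rr[d] := W[N[a]] *)
| OutW (a s : nat)            (* Out[N[a]] := N[s] *)
| Jmp (t : nat)               (* pc := t *)
| JmpZ (a t : nat)            (* if N[a] = 0 then pc := t *)
| JmpRLe (a b t : nat)        (* if Rr[a] <= Rr[b] then pc := t *)
| Halt.

Definition program := list instr.

Record config : Type := mkConfig {
  pc : nat;
  nreg : nat -> nat;
  rreg : nat -> R;
  out : nat -> nat
}.

Definition upd {A : Type} (f : nat -> A) (a : nat) (x : A) : nat -> A :=
  fun y => if Nat.eqb y a then x else f y.

(* one step; None means the machine has halted (Halt or pc out of range) *)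
Definition step (p : program) (In_ : nat -> nat) (W : nat -> R) (c : config)
    : option config :=
  let N := nreg c in let Rr := rreg c in let nx := S (pc c) in
  match nth_error p (pc c) with
  | None | Some Halt => None
  | Some (NConst d k) => Some (mkConfig nx (upd N d k) Rr (out c))
  | Some (NAdd d a b) => Some (mkConfig nx (upd N d (N a + N b)%nat) Rr (out c))
  | Some (NSub d a b) => Some (mkConfig nx (upd N d (N a - N b)%nat) Rr (out c))
  | Some (NLoad d a) => Some (mkConfig nx (upd N d (N (N a))) Rr (out c))
  | Some (NStore a s) => Some (mkConfig nx (upd N (N a) (N s)) Rr (out c))
  | Some (NIn d a) => Some (mkConfig nx (upd N d (In_ (N a))) Rr (out c))
  | Some (RZero d) => Some (mkConfig nx N (upd Rr d 0) (out c))
  | Some (RAdd d a b) => Some (mkConfig nx N (upd Rr d (Rr a + Rr b)) (out c))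
  | Some (RSub d a b) => Some (mkConfig nx N (upd Rr d (Rr a - Rr b)) (out c))
  | Some (RLoad d a) => Some (mkConfig nx N (upd Rr d (Rr (N a))) (out c))
  | Some (RStore a s) => Some (mkConfig nx N (upd Rr (N a) (Rr s)) (out c))
  | Some (RIn d a) => Some (mkConfig nx N (upd Rr d (W (N a))) (out c))
  | Some (OutW a s) => Some (mkConfig nx N Rr (upd (out c) (N a) (N s)))
  | Some (Jmp t) => Some (mkConfig t N Rr (out c))
  | Some (JmpZ a t) =>
      Some (mkConfig (if Nat.eqb (N a) 0 then t else nx) N Rr (out c))
  | Some (JmpRLe a b t) =>
      Some (mkConfig (if Rle_dec (Rr a) (Rr b) then t else nx) N Rr (out c))
  end.

(* exec p In W fuel c = Some c' iff the machine started in c halts in the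
   final configuration c' after fewer than fuel executed instructions *)
Fixpoint exec (p : program) (In_ : nat -> nat) (W : nat -> R) (fuel : nat) (c : config)
    : option config :=
  match fuel with
  | O => None
  | S f => match step p In_ W c with
           | None => Some c
           | Some c' => exec p In_ W f c'
           end
  end.

Definition init_config : config := mkConfig 0 (fun _ => 0%nat) (fun _ => 0) (fun _ => 0%nat).

(* Input encoding of (V, K/I partition, edge list) on the nat input tape:
   In[0] = |V|, In[1] = |E|, In[2+v] = [v in K] for v < |V|,
   In[2+|V|+2i], In[2+|V|+2i+1] = endpoints of the i-th edge; 0 elsewhere.
   The weights are on the real input tape: W[v] = w(v). *)
Definition encode_input (n : nat) (inK : nat -> bool) (E : list (nat * nat)) : nat -> nat :=
  fun a =>
    if Nat.eqb a 0 then n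
    else if Nat.eqb a 1 then length E
    else if Nat.ltb a (2 + n) then (if inK (a - 2)%nat then 1%nat else 0%nat)
    else let j := (a - (2 + n))%nat in
         match nth_error E (Nat.div j 2) with
         | Some (u, v) => if Nat.eqb (Nat.modulo j 2) 0 then u else v
         | None => 0%nat
         end.

Definition output_set (n : nat) (c : config) : nat -> Prop :=
  fun v => (v < n)%nat /\ out c v <> 0%nat.

(* Main.v *)
Require Import Defs.
From Stdlib Require Import Reals List Arith Lia Lra Bool.
Import ListNotations.
Local Open Scope nat_scope.
Local Arguments nth_error : simpl never.

(** A set F of vertices is feasible iff every neighbour in I of a clique vertex
    of F lies in F, with at most one exception i0; an exception is allowed only
    if F contains all clique vertices that are not adjacent to i0.  (The first
    clique vertex removed while its neighbour i0 survives forces i0 to be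
    adjacent to all surviving clique vertices.)  For each choice of i0, or of no
    exception, the sets in question are the closed sets of a digraph, so the
    problem reduces to |I| + 1 maximum-weight closure problems.

    A closure problem is solved by push-relabel: weights are initial excesses,
    arcs have infinite capacity, labels are capped at M + 1 for M nodes.  A round
    that scans all nodes either raises a label or lowers the maximal label of an
    active node, so (M + 2)^3 rounds suffice.  Among the M + 1 levels 1, ...,
    M + 1 some level g is empty, and the nodes above g form an optimal closed set.

    The algorithm uses only bounded loops; it is written in a small for-language
    whose loop bounds are read-only registers, so that its running time is
    bounded by a polynomial that can be read off the syntax. *)

(** * A for-language compiled to the RAM *)

(** The real RAM only adds, subtracts and compares weights, and the number of steps must not depend
    on them. This calls for a strongly polynomial combinatorial method. Push-relabel also admits a
    number of rounds fixed in advance, so that no loop needs a termination test, and the empty level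
    replaces the graph search that would otherwise extract a minimum cut. There is no source or
    sink: negative weights are deficits, which absorb excess at label 0.

    A single exception suffices because [I] is independent: a clique vertex is not simplicial while
    two of its [I]-neighbours survive. Suppose clique vertices k and k' of F have distinct
    neighbours i and i' outside F. If k' is adjacent to i, then k' sees both i and i' when it is
    removed. Otherwise k' is removed before k, since all clique vertices surviving with k are
    adjacent to i. At that moment k' sees k and i', so k is adjacent to i', and k sees both i and i'
    when it is removed. Both cases are impossible. *)

Record state : Type := mkState {
  ns : nat -> nat;
  na : nat -> nat -> nat;
  rs : nat -> R;
  ra : nat -> nat -> R;
  so : nat -> nat
}.

Inductive op : Type :=
| OConst (d c : nat)
| OAdd (d a b : nat)
| OSub (d a b : nat)
| OIn (d a : nat)
| OLd (d id a : nat)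
| OSt (id a s : nat)
| ORZero (d : nat)
| ORAdd (d a b : nat)
| ORSub (d a b : nat)
| ORIn (d a : nat)
| ORLd (d id a : nat)
| ORSt (id a s : nat)
| OOut (a s : nat).

Inductive cmd : Type :=
| Do (o : op)
| Skip
| Seq (c1 c2 : cmd)
| IfZ (a : nat) (c1 c2 : cmd)
| IfR (a b : nat) (c1 c2 : cmd)
| For (i q : nat) (c : cmd).

Definition setn (d x : nat) (s : state) : state :=
  mkState (upd (ns s) d x) (na s) (rs s) (ra s) (so s).
Definition setr (d : nat) (x : R) (s : state) : state :=
  mkState (ns s) (na s) (upd (rs s) d x) (ra s) (so s).
Definition setna (id a x : nat) (s : state) : state :=
  mkState (ns s) (upd (na s) id (upd (na s id) a x)) (rs s) (ra s) (so s).
Definition setra (id a : nat) (x : R) (s : state) : state :=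
  mkState (ns s) (na s) (rs s) (upd (ra s) id (upd (ra s id) a x)) (so s).
Definition seto (a x : nat) (s : state) : state :=
  mkState (ns s) (na s) (rs s) (ra s) (upd (so s) a x).

Definition runop (inp : nat -> nat) (W : nat -> R) (o : op) (s : state) : state :=
  match o with
  | OConst d c => setn d c s
  | OAdd d a b => setn d (ns s a + ns s b) s
  | OSub d a b => setn d (ns s a - ns s b) s
  | OIn d a => setn d (inp (ns s a)) s
  | OLd d id a => setn d (na s id (ns s a)) s
  | OSt id a x => setna id (ns s a) (ns s x) s
  | ORZero d => setr d 0%R s
  | ORAdd d a b => setr d (rs s a + rs s b)%R s
  | ORSub d a b => setr d (rs s a - rs s b)%R s
  | ORIn d a => setr d (W (ns s a)) s
  | ORLd d id a => setr d (ra s id (ns s a)) s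
  | ORSt id a x => setra id (ns s a) (rs s x) s
  | OOut a x => seto (ns s a) (ns s x) s
  end.

(** The counter holds the number of completed iterations and ends at the bound, exactly as in the
    compiled loop, where it is an ordinary register visible to the body. *)
Fixpoint loop (body : state -> state) (i k : nat) (s : state) : state :=
  match k with
  | 0 => setn i 0 s
  | S k' => setn i (S k') (body (loop body i k' s))
  end.

Fixpoint run (inp : nat -> nat) (W : nat -> R) (c : cmd) (s : state) : state :=
  match c with
  | Do o => runop inp W o s
  | Skip => s
  | Seq c1 c2 => run inp W c2 (run inp W c1 s)
  | IfZ a c1 c2 => if Nat.eqb (ns s a) 0 then run inp W c1 s else run inp W c2 s
  | IfR a b c1 c2 =>
      if Rle_dec (rs s a) (rs s b) then run inp W c1 s else run inp W c2 s
  | For i q c => loop (run inp W c) i (ns s q) s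
  end.

(** * Compilation to code with absolute jumps *)

Definition cell (id x : nat) : nat := 32 + id + 8 * x.

(** The eight arrays interleave above the 32 scalar registers, so none needs a declared length. The
    stride is a power of two because the RAM has no multiplication: three doublings give [8 * a]. *)
Definition addr (id a : nat) : list instr :=
  [NAdd 30 a a; NAdd 30 30 30; NAdd 30 30 30; NConst 31 (32 + id); NAdd 30 31 30].

Definition opcode (o : op) : list instr :=
  match o with
  | OConst d c => [NConst d c]
  | OAdd d a b => [NAdd d a b]
  | OSub d a b => [NSub d a b]
  | OIn d a => [NIn d a]
  | OLd d id a => addr id a ++ [NLoad d 30]
  | OSt id a x => addr id a ++ [NStore 30 x]
  | ORZero d => [RZero d]
  | ORAdd d a b => [RAdd d a b]
  | ORSub d a b => [RSub d a b]
  | ORIn d a => [RIn d a]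
  | ORLd d id a => addr id a ++ [RLoad d 30]
  | ORSt id a x => addr id a ++ [RStore 30 x]
  | OOut a x => [OutW a x]
  end.

(** The code length does not depend on the position, so forward jump targets are known before the
    code is generated. *)
Fixpoint clen (c : cmd) : nat :=
  match c with
  | Do o => length (opcode o)
  | Skip => 0
  | Seq c1 c2 => clen c1 + clen c2
  | IfZ _ c1 c2 => 2 + clen c2 + clen c1
  | IfR _ _ c1 c2 => 2 + clen c2 + clen c1
  | For _ _ c => clen c + 6
  end.

(** [b] is the absolute address of the first instruction. In a conditional the second branch comes
    first in memory, because the machine jumps when the test succeeds. *)
Fixpoint compile (b : nat) (c : cmd) : list instr :=
  match c with
  | Do o => opcode o
  | Skip => []
  | Seq c1 c2 => compile b c1 ++ compile (b + clen c1) c2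
  | IfZ a c1 c2 =>
      JmpZ a (b + 2 + clen c2) :: compile (S b) c2 ++
      Jmp (b + 2 + clen c2 + clen c1) :: compile (b + 2 + clen c2) c1
  | IfR x y c1 c2 =>
      JmpRLe x y (b + 2 + clen c2) :: compile (S b) c2 ++
      Jmp (b + 2 + clen c2 + clen c1) :: compile (b + 2 + clen c2) c1
  | For i q c =>
      NConst i 0 :: NSub 30 q i :: JmpZ 30 (b + clen c + 6) ::
      compile (S (S (S b))) c ++ [NConst 31 1; NAdd i i 31; Jmp (S b)]
  end.

Lemma compile_length (c : cmd) (pos : nat) : length (compile pos c) = clen c.
Proof.
  revert pos; induction c; intros pos; simpl; auto;
    rewrite ?length_app; simpl; rewrite ?IHc1, ?IHc2, ?IHc; simpl; lia.
Qed.

(* Registers 0-7 are read-only and serve as loop bounds, 8-29 are scalars,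
   30 and 31 are scratch for address computations. *)
Definition scal (d : nat) : bool := (8 <=? d) && (d <? 30).

Definition wfop (o : op) : bool :=
  match o with
  | OConst d c => scal d
  | OAdd d a b | OSub d a b => scal d && (a <? 30) && (b <? 30)
  | OIn d a => scal d && (a <? 30)
  | OLd d id a => scal d && (id <? 8) && (a <? 30)
  | OSt id a x => (id <? 8) && (a <? 30) && (x <? 30)
  | ORZero d => d <? 32
  | ORAdd d a b | ORSub d a b => (d <? 32) && (a <? 32) && (b <? 32)
  | ORIn d a => (d <? 32) && (a <? 30)
  | ORLd d id a => (d <? 32) && (id <? 8) && (a <? 30)
  | ORSt id a x => (id <? 8) && (a <? 30) && (x <? 32)
  | OOut a x => (a <? 30) && (x <? 30)
  end.

(** * Syntactic frame conditions *)

Definition nowrop (x : nat) (o : op) : bool :=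
  match o with
  | OConst d _ | OAdd d _ _ | OSub d _ _ | OIn d _ | OLd d _ _ => negb (x =? d)
  | _ => true
  end.

Fixpoint nowr (x : nat) (c : cmd) : bool :=
  match c with
  | Do o => nowrop x o
  | Skip => true
  | Seq c1 c2 | IfZ _ c1 c2 | IfR _ _ c1 c2 => nowr x c1 && nowr x c2
  | For i _ c => negb (x =? i) && nowr x c
  end.

Fixpoint wf (c : cmd) : bool :=
  match c with
  | Do o => wfop o
  | Skip => true
  | Seq c1 c2 => wf c1 && wf c2
  | IfZ a c1 c2 => (a <? 30) && wf c1 && wf c2
  | IfR a b c1 c2 => (a <? 32) && (b <? 32) && wf c1 && wf c2
  | For i q c => scal i && (q <? 8) && nowr i c && wf c
  end.

Definition nowrnaop (id : nat) (o : op) : bool :=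
  match o with OSt j _ _ => negb (id =? j) | _ => true end.
Definition nowrrsop (x : nat) (o : op) : bool :=
  match o with
  | ORZero d | ORAdd d _ _ | ORSub d _ _ | ORIn d _ | ORLd d _ _ => negb (x =? d)
  | _ => true
  end.
Definition nowrraop (id : nat) (o : op) : bool :=
  match o with ORSt j _ _ => negb (id =? j) | _ => true end.
Definition nowrsoop (o : op) : bool :=
  match o with OOut _ _ => false | _ => true end.

Fixpoint allops (f : op -> bool) (c : cmd) : bool :=
  match c with
  | Do o => f o
  | Skip => true
  | Seq c1 c2 | IfZ _ c1 c2 | IfR _ _ c1 c2 => allops f c1 && allops f c2
  | For _ _ c => allops f c
  end.

Lemma upd_neq {A : Type} (f : nat -> A) (a : nat) (x : A) (y : nat) :
  y <> a -> upd f a x y = f y.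
Proof. unfold upd; destruct (Nat.eqb_spec y a); congruence. Qed.

Lemma upd_eq {A : Type} (f : nat -> A) (a : nat) (x : A) : upd f a x a = x.
Proof. unfold upd; now rewrite Nat.eqb_refl. Qed.

Lemma nowr_run (inp : nat -> nat) (W : nat -> R) (x : nat) (c : cmd) (s : state) :
  nowr x c = true -> ns (run inp W c s) x = ns s x.
Proof.
  revert s; induction c; intros s; simpl; rewrite ?andb_true_iff, ?negb_true_iff.
  - destruct o; simpl; rewrite ?negb_true_iff, ?Nat.eqb_neq; intros H; auto;
      apply upd_neq; auto.
  - auto.
  - intros [H1 H2]; rewrite IHc2, IHc1; auto.
  - intros [H1 H2]; destruct Nat.eqb; auto.
  - intros [H1 H2]; destruct Rle_dec; auto.
  - rewrite Nat.eqb_neq; intros [H1 H2]; generalize (ns s q) as k.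
    induction k; simpl; rewrite upd_neq; auto; now rewrite IHc.
Qed.

(** A single induction serves all components of the state except the natural scalars: those are also
    written by [For] itself and are treated by [nowr_run]. The conditions are boolean, so the frame
    of a concrete fragment is checked by evaluation. *)
Lemma allops_run {A : Type} (P : state -> A) (f : op -> bool)
    (inp : nat -> nat) (W : nat -> R) (c : cmd) (s : state) :
  (forall o s, f o = true -> P (runop inp W o s) = P s) ->
  (forall i k s, P (setn i k s) = P s) ->
  allops f c = true -> P (run inp W c s) = P s.
Proof.
  intros Ho Hn; revert s; induction c; intros s; simpl; rewrite ?andb_true_iff; auto.
  - intros [H1 H2]; rewrite IHc2, IHc1; auto.
  - intros [H1 H2]; destruct Nat.eqb; auto.
  - intros [H1 H2]; destruct Rle_dec; auto.
  - intros H; generalize (ns s q) as k.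
    induction k; simpl; rewrite Hn; auto; now rewrite IHc.
Qed.

Lemma nowrna_run (inp : nat -> nat) (W : nat -> R) (id : nat) (c : cmd) (s : state) :
  allops (nowrnaop id) c = true -> na (run inp W c s) id = na s id.
Proof.
  apply (allops_run (fun s => na s id)); auto.
  intros [] t; simpl; auto; rewrite negb_true_iff, Nat.eqb_neq; apply upd_neq.
Qed.

Lemma nowrra_run (inp : nat -> nat) (W : nat -> R) (id : nat) (c : cmd) (s : state) :
  allops (nowrraop id) c = true -> ra (run inp W c s) id = ra s id.
Proof.
  apply (allops_run (fun s => ra s id)); auto.
  intros [] t; simpl; auto; rewrite negb_true_iff, Nat.eqb_neq; apply upd_neq.
Qed.

Lemma nowrrs_run (inp : nat -> nat) (W : nat -> R) (x : nat) (c : cmd) (s : state) :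
  allops (nowrrsop x) c = true -> rs (run inp W c s) x = rs s x.
Proof.
  apply (allops_run (fun s => rs s x)); auto.
  intros [] t; simpl; auto; rewrite negb_true_iff, Nat.eqb_neq; apply upd_neq.
Qed.

Lemma nowrso_run (inp : nat -> nat) (W : nat -> R) (c : cmd) (s : state) :
  allops nowrsoop c = true -> so (run inp W c s) = so s.
Proof.
  apply (allops_run so); auto.
  intros [] t; simpl; auto; discriminate.
Qed.

Lemma scal_spec (d : nat) : scal d = true <-> 8 <= d < 30.
Proof. unfold scal; rewrite andb_true_iff, Nat.leb_le, Nat.ltb_lt; tauto. Qed.

Lemma wf_nowr (x : nat) (c : cmd) : x < 8 -> wf c = true -> nowr x c = true.
Proof.
  intros Hx; induction c; simpl; rewrite ?andb_true_iff; try tauto.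
  - destruct o; simpl; rewrite ?andb_true_iff, ?scal_spec, ?negb_true_iff, ?Nat.eqb_neq;
      auto; lia.
  - rewrite scal_spec, negb_true_iff, Nat.eqb_neq; intros [[[H1 H2] H3] H4].
    split; auto; lia.
Qed.

(** * Machine runs, simulation and cost *)

Fixpoint nsteps (p : program) (inp : nat -> nat) (W : nat -> R) (t : nat) (c : config)
    : option config :=
  match t with
  | 0 => Some c
  | S t' => match step p inp W c with None => None | Some c' => nsteps p inp W t' c' end
  end.

Lemma nsteps_add p inp W t1 t2 c c1 c2 :
  nsteps p inp W t1 c = Some c1 -> nsteps p inp W t2 c1 = Some c2 ->
  nsteps p inp W (t1 + t2) c = Some c2.
Proof.
  revert c; induction t1; simpl; intros c; [congruence|].
  destruct step; [auto|discriminate].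
Qed.

(** [exec] describes only halting runs and does not compose, so fragments are measured by [nsteps]
    and converted once at the end. The inequality is strict because noticing the halt consumes one
    unit of fuel. *)
Lemma exec_nsteps p inp W t fuel c c' :
  nsteps p inp W t c = Some c' -> step p inp W c' = None -> t < fuel ->
  exec p inp W fuel c = Some c'.
Proof.
  revert fuel c; induction t; intros fuel c; simpl; intros H Hh Hf;
    (destruct fuel as [|fuel]; [lia|simpl]).
  - injection H as ->; now rewrite Hh.
  - destruct (step p inp W c); [|discriminate]; apply IHt; auto; lia.
Qed.

Fixpoint code_at (p : program) (b : nat) (l : list instr) : Prop :=
  match l with
  | [] => True
  | i :: l' => nth_error p b = Some i /\ code_at p (S b) l'
  end.

Lemma code_at_app p b l1 l2 :
  code_at p b (l1 ++ l2) <-> code_at p b l1 /\ code_at p (b + length l1) l2.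
Proof.
  revert b; induction l1; intros b; simpl.
  - rewrite Nat.add_0_r; tauto.
  - rewrite IHl1, Nat.add_succ_r; simpl; tauto.
Qed.

Lemma code_at_self (l1 l2 l3 : list instr) : code_at (l1 ++ l2 ++ l3) (length l1) l2.
Proof.
  revert l1; induction l2; intros l1; simpl; auto; split.
  - rewrite nth_error_app2, Nat.sub_diag; auto.
  - specialize (IHl2 (l1 ++ [a])); rewrite <- app_assoc, length_app, Nat.add_1_r in IHl2.
    exact IHl2.
Qed.

(** Nothing is said about the program counter or about the natural registers 30 and 31, so jumps and
    address computations preserve the relation. Real registers 30 and 31 are ordinary scalars. *)
Record sim (s : state) (c : config) : Prop := mkSim {
  sim_ns : forall x, x < 30 -> nreg c x = ns s x;
  sim_na : forall id x, id < 8 -> nreg c (cell id x) = na s id x;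
  sim_rs : forall x, x < 32 -> rreg c x = rs s x;
  sim_ra : forall id x, id < 8 -> rreg c (cell id x) = ra s id x;
  sim_so : forall x, out c x = so s x
}.

Lemma sim_setn s c i x b : sim s c -> i < 32 ->
  sim (setn i x s) (mkConfig b (upd (nreg c) i x) (rreg c) (out c)).
Proof.
  intros [H1 H2 H3 H4 H5] Hi; split; simpl; auto; intros.
  - unfold upd; destruct Nat.eqb; auto.
  - rewrite upd_neq; auto; unfold cell; lia.
Qed.

Lemma sim_scratch s c i x b : sim s c -> 30 <= i < 32 ->
  sim s (mkConfig b (upd (nreg c) i x) (rreg c) (out c)).
Proof.
  intros [H1 H2 H3 H4 H5] Hi; split; simpl; auto; intros; rewrite upd_neq; auto.
  - lia.
  - unfold cell; lia.
Qed.

Lemma sim_pc s c b : sim s c -> sim s (mkConfig b (nreg c) (rreg c) (out c)).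
Proof. intros []; split; auto. Qed.

Lemma addr_correct p inp W id a s c :
  id < 8 -> a < 30 -> code_at p (pc c) (addr id a) -> sim s c ->
  exists c', nsteps p inp W 5 c = Some c' /\ pc c' = pc c + 5 /\ sim s c' /\
    nreg c' 30 = cell id (ns s a).
Proof.
  intros Hid Ha Hc Hs; destruct c as [b N Rr O]; simpl in Hc.
  destruct Hc as (I1 & I2 & I3 & I4 & I5 & _).
  eexists; split; [|split; [|split]].
  - cbn [nsteps]; unfold step; cbn [pc]; rewrite I1; cbn [pc]; rewrite I2; cbn [pc];
    rewrite I3; cbn [pc]; rewrite I4; cbn [pc]; rewrite I5; reflexivity.
  - simpl; lia.
  - destruct Hs as [H1 H2 H3 H4 H5]; split; simpl in *; auto; intros.
    rewrite !upd_neq; auto; lia.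
  - simpl. unfold upd; simpl. unfold cell. rewrite <- (sim_ns _ _ Hs a Ha); simpl. lia.
Qed.

Lemma op_correct p inp W o s c :
  wfop o = true -> code_at p (pc c) (opcode o) -> sim s c ->
  exists c', nsteps p inp W (length (opcode o)) c = Some c' /\
    pc c' = pc c + length (opcode o) /\ sim (runop inp W o s) c'.
Proof.
  assert (cell_lt : forall id x, 32 <= cell id x) by (unfold cell; lia).
  assert (cell_inj : forall id x id' x', id < 8 -> id' < 8 ->
    cell id x = cell id' x' -> id = id' /\ x = x') by (unfold cell; lia).
  destruct o; simpl wfop; rewrite ?andb_true_iff, ?scal_spec, ?Nat.ltb_lt; intros Hw;
   try (intros [I _] Hs; eexists; split;
     [simpl; unfold step; rewrite I; reflexivity
     |split; [simpl; lia
     |destruct Hs as [H1 H2 H3 H4 H5]; split; simpl; auto; intros;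
      try specialize (cell_lt id x);
      rewrite ?H1, ?H3 by lia;
      try (rewrite !upd_neq by lia; auto);
      unfold upd; destruct Nat.eqb; auto; fail]]).
  all: unfold opcode; rewrite code_at_app; intros [I1 [I2 _]] Hs;
    destruct (addr_correct p inp W id a s c) as (c1 & E1 & P1 & S1 & A1); try tauto;
    assert (LA : length (addr id a) = 5) by reflexivity; rewrite length_app, LA;
    rewrite LA, <- P1 in I2;
    eexists; (split;
     [eapply nsteps_add; [exact E1|]; simpl; unfold step; rewrite I2; reflexivity|]);
    (split; [simpl; lia|]);
    destruct S1 as [H1 H2 H3 H4 H5]; split; simpl; auto; intros.
  - rewrite A1, H2 by tauto; unfold upd; destruct Nat.eqb; auto.
  - specialize (cell_lt id0 x); rewrite upd_neq by lia; auto.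
  - specialize (cell_lt id (ns s a)); rewrite A1, upd_neq by lia; auto.
  - rewrite A1, H1 by tauto; unfold upd.
    destruct (Nat.eqb_spec (cell id0 x) (cell id (ns s a))) as [E|E].
    + apply cell_inj in E as [-> ->]; try tauto; now rewrite !Nat.eqb_refl.
    + destruct (Nat.eqb_spec id0 id) as [->|]; auto.
      destruct (Nat.eqb_spec x (ns s a)) as [->|]; [tauto|auto].
  - rewrite A1, H4 by tauto; unfold upd; destruct Nat.eqb; auto.
  - specialize (cell_lt id0 x); rewrite upd_neq by lia; auto.
  - specialize (cell_lt id (ns s a)); rewrite A1, upd_neq by lia; auto.
  - rewrite A1, H3 by tauto; unfold upd.
    destruct (Nat.eqb_spec (cell id0 x) (cell id (ns s a))) as [E|E].
    + apply cell_inj in E as [-> ->]; try tauto; now rewrite !Nat.eqb_refl.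
    + destruct (Nat.eqb_spec id0 id) as [->|]; auto.
      destruct (Nat.eqb_spec x (ns s a)) as [->|]; [tauto|auto].
Qed.

(** An array access takes five address instructions and one access. A loop pays three instructions
    for its initialisation and final test, and per iteration two for the test and three for the
    increment and the jump back. Both branches of a conditional are charged. *)
Fixpoint cost (P : nat -> nat) (c : cmd) : nat :=
  match c with
  | Do o => 6
  | Skip => 0
  | Seq c1 c2 => cost P c1 + cost P c2
  | IfZ _ c1 c2 | IfR _ _ c1 c2 => 2 + cost P c1 + cost P c2
  | For _ q c => 3 + P q * (5 + cost P c)
  end.

(** Well-formed code never writes registers below 8, so the values [P] of the loop bounds stay valid
    throughout and the cost can be fixed before the run. *)
Lemma compile_correct p inp W P c : forall s m,
  wf c = true -> code_at p (pc m) (compile (pc m) c) -> sim s m ->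
  (forall q, q < 8 -> ns s q = P q) ->
  exists t m', t <= cost P c /\ nsteps p inp W t m = Some m' /\
    pc m' = pc m + clen c /\ sim (run inp W c s) m'.
Proof.
  induction c; intros s m; simpl wf; rewrite ?andb_true_iff, ?Nat.ltb_lt, ?scal_spec;
    intros Hw Hc Hs HP.
  - destruct (op_correct p inp W o s m) as (m' & E & Q & Hm'); auto.
    exists (length (opcode o)), m'; simpl; repeat split; auto; try apply Hm'.
    destruct o; simpl; lia.
  - exists 0, m; simpl; repeat split; auto; try apply Hs.
  - simpl in Hc; rewrite code_at_app, compile_length in Hc; destruct Hc as [C1 C2].
    destruct (IHc1 s m) as (t1 & m1 & L1 & E1 & Q1 & S1); try tauto.
    rewrite <- Q1 in C2.
    destruct (IHc2 (run inp W c1 s) m1) as (t2 & m2 & L2 & E2 & Q2 & S2); try tauto.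
    { intros q Hq; rewrite nowr_run; auto; apply wf_nowr; tauto. }
    exists (t1 + t2), m2; simpl; split; [lia|split; [|split]]; auto.
    + eapply nsteps_add; eauto.
    + lia.
  - destruct Hw as [[Ha W1] W2].
    destruct Hc as [I1 Hc]; fold compile in Hc; rewrite code_at_app, compile_length in Hc;
      destruct Hc as [C2 [I2 C1]]; fold code_at in C1.
    simpl run; rewrite <- (sim_ns _ _ Hs a Ha).
    destruct (Nat.eqb_spec (nreg m a) 0) as [E|E].
    + destruct (IHc1 s (mkConfig (pc m + 2 + clen c2) (nreg m) (rreg m) (out m)))
        as (t & m' & L & X & Q & S'); auto using sim_pc.
      { simpl; replace (pc m + 2 + clen c2) with (S (S (pc m) + clen c2)) in * by lia; auto. }
      exists (S t), m'; simpl; split; [lia|split; [|split]]; auto.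
      * unfold step; rewrite I1, E; exact X.
      * rewrite Q; simpl; lia.
    + destruct (IHc2 s (mkConfig (S (pc m)) (nreg m) (rreg m) (out m)))
        as (t & m' & L & X & Q & S'); auto using sim_pc.
      cbn [pc] in Q; rewrite <- Q in I2.
      exists (S (t + 1)), (mkConfig (pc m + 2 + clen c2 + clen c1) (nreg m') (rreg m') (out m')).
      split; [simpl; lia|split; [|split]]; auto using sim_pc.
      * simpl; unfold step at 1; rewrite I1.
        apply Nat.eqb_neq in E; rewrite E.
        eapply nsteps_add; eauto; simpl; unfold step; rewrite I2; reflexivity.
      * simpl; lia.
  - destruct Hw as [[[Ha Hb] W1] W2].
    destruct Hc as [I1 Hc]; fold compile in Hc; rewrite code_at_app, compile_length in Hc;
      destruct Hc as [C2 [I2 C1]]; fold code_at in C1.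
    simpl run; rewrite <- (sim_rs _ _ Hs a Ha), <- (sim_rs _ _ Hs b Hb).
    destruct (Rle_dec (rreg m a) (rreg m b)) as [E|E].
    + destruct (IHc1 s (mkConfig (pc m + 2 + clen c2) (nreg m) (rreg m) (out m)))
        as (t & m' & L & X & Q & S'); auto using sim_pc.
      { simpl; replace (pc m + 2 + clen c2) with (S (S (pc m) + clen c2)) in * by lia; auto. }
      exists (S t), m'; simpl; split; [lia|split; [|split]]; auto.
      * unfold step; rewrite I1; destruct Rle_dec; [exact X|tauto].
      * rewrite Q; simpl; lia.
    + destruct (IHc2 s (mkConfig (S (pc m)) (nreg m) (rreg m) (out m)))
        as (t & m' & L & X & Q & S'); auto using sim_pc.
      cbn [pc] in Q; rewrite <- Q in I2.
      exists (S (t + 1)), (mkConfig (pc m + 2 + clen c2 + clen c1) (nreg m') (rreg m') (out m')).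
      split; [simpl; lia|split; [|split]]; auto using sim_pc.
      * simpl; unfold step at 1; rewrite I1.
        destruct Rle_dec; [tauto|].
        eapply nsteps_add; eauto; simpl; unfold step; rewrite I2; reflexivity.
      * simpl; lia.
  - destruct Hw as [[[Hi Hq] Wi] Wc].
    destruct Hc as [I1 [I2 [I3 Hc]]]; fold code_at compile in Hc.
    rewrite code_at_app, compile_length in Hc; destruct Hc as [C1 (I4 & I5 & I6 & _)].
    (* Loop invariant at the test instruction [S (pc m)], after the initialisation and [k] full
       iterations. *)
    assert (Hk : forall k, k <= P q -> exists t m', t <= 1 + k * (5 + cost P c) /\
      nsteps p inp W t m = Some m' /\ pc m' = S (pc m) /\
      sim (loop (run inp W c) i k s) m' /\
      (forall r, r < 8 -> ns (loop (run inp W c) i k s) r = P r) /\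
      ns (loop (run inp W c) i k s) i = k).
    { induction k; intros Hk.
      - exists 1, (mkConfig (S (pc m)) (upd (nreg m) i 0) (rreg m) (out m)).
        split; [lia|split; [|split; [|split; [|split]]]]; simpl; auto.
        + unfold step; now rewrite I1.
        + apply sim_setn; auto; lia.
        + intros r Hr; rewrite upd_neq; auto; lia.
        + apply upd_eq.
      - destruct IHk as (t & m1 & L1 & E1 & Q1 & S1 & P1 & N1); [lia|].
        set (s1 := loop (run inp W c) i k s) in *.
        set (m2 := mkConfig (S (S (S (pc m)))) (upd (nreg m1) 30 (P q - k)) (rreg m1) (out m1)).
        assert (E2 : nsteps p inp W 2 m1 = Some m2).
        { simpl; unfold step at 1; rewrite Q1, I2.
          rewrite (sim_ns _ _ S1 q), (sim_ns _ _ S1 i), P1, N1 by lia.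
          unfold step; simpl pc; rewrite I3; simpl.
          rewrite upd_eq; destruct (Nat.eqb_spec (P q - k) 0); [lia|reflexivity]. }
        assert (S2 : sim s1 m2) by (apply sim_scratch; auto; lia).
        destruct (IHc s1 m2) as (t3 & m3 & L3 & E3 & Q3 & S3); auto.
        cbn [pc m2] in Q3; rewrite <- Q3 in I4, I5, I6.
        assert (N3 : nreg m3 i = k).
        { rewrite (sim_ns _ _ S3) by lia; rewrite nowr_run; auto. }
        exists (t + (2 + (t3 + 3))).
        exists (mkConfig (S (pc m)) (upd (upd (nreg m3) 31 1) i (S k)) (rreg m3) (out m3)).
        split; [lia|split; [|split; [|split; [|split]]]]; simpl loop; auto.
        + eapply nsteps_add; [exact E1|]; eapply nsteps_add; [exact E2|].
          eapply nsteps_add; [exact E3|].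
          simpl; unfold step at 1; rewrite I4; unfold step at 1; simpl pc; rewrite I5.
          unfold step at 1; simpl pc; rewrite I6; simpl.
          rewrite upd_eq, upd_neq, N3, Nat.add_1_r by lia; reflexivity.
        + apply (sim_setn _ (mkConfig 0 (upd (nreg m3) 31 1) (rreg m3) (out m3))); auto; [|lia].
          apply sim_scratch; auto; lia.
        + intros r Hr; fold s1; simpl; rewrite upd_neq, nowr_run; auto using wf_nowr; lia.
        + simpl; apply upd_eq. }
    destruct (Hk (P q)) as (t & m1 & L1 & E1 & Q1 & S1 & P1 & N1); auto.
    exists (t + 2), (mkConfig (pc m + clen c + 6) (upd (nreg m1) 30 0) (rreg m1) (out m1)).
    split; [simpl; lia|split; [|split]].
    + eapply nsteps_add; [exact E1|].
      simpl; unfold step at 1; rewrite Q1, I2.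
      rewrite (sim_ns _ _ S1 q), (sim_ns _ _ S1 i), P1, N1 by lia.
      rewrite Nat.sub_diag; unfold step; simpl pc; rewrite I3; simpl; reflexivity.
    + simpl; lia.
    + simpl run; rewrite HP by lia; apply sim_scratch; auto; lia.
Qed.

(** * A polynomial read off the syntax *)

Fixpoint csize (c : cmd) : nat :=
  match c with
  | Do o => 6
  | Skip => 0
  | Seq c1 c2 => csize c1 + csize c2
  | IfZ _ c1 c2 | IfR _ _ c1 c2 => 2 + csize c1 + csize c2
  | For _ _ c => 8 + csize c
  end.

Fixpoint depth (c : cmd) : nat :=
  match c with
  | Do _ | Skip => 0
  | Seq c1 c2 | IfZ _ c1 c2 | IfR _ _ c1 c2 => Nat.max (depth c1) (depth c2)
  | For _ _ c => S (depth c)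
  end.

(** Each loop contributes one factor [Y], so the nesting depth is the degree. The 8 in [csize]
    collects the three instructions outside the iterations and the five per iteration. *)
Lemma cost_le (P : nat -> nat) (Y : nat) (c : cmd) :
  wf c = true -> 1 <= Y -> (forall q, q < 8 -> P q <= Y) ->
  cost P c <= csize c * Y ^ depth c.
Proof.
  intros Hw HY HP.
  assert (Hmon : forall a b x, a <= b -> x * Y ^ a <= x * Y ^ b).
  { intros; apply Nat.mul_le_mono_l, Nat.pow_le_mono_r; lia. }
  assert (Hpos : forall a, 1 <= Y ^ a).
  { intros a; apply Nat.neq_0_lt_0, Nat.pow_nonzero; lia. }
  assert (Htwo : forall c1 c2, cost P c1 <= csize c1 * Y ^ depth c1 ->
    cost P c2 <= csize c2 * Y ^ depth c2 ->
    cost P c1 + cost P c2 <=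
    (csize c1 + csize c2) * Y ^ Nat.max (depth c1) (depth c2)).
  { intros c1 c2 H1 H2.
    pose proof (Hmon _ _ (csize c1) (Nat.le_max_l (depth c1) (depth c2))).
    pose proof (Hmon _ _ (csize c2) (Nat.le_max_r (depth c1) (depth c2))).
    lia. }
  induction c; simpl in *; rewrite ?andb_true_iff in Hw.
  - lia.
  - lia.
  - apply Htwo; tauto.
  - specialize (Htwo c1 c2 ltac:(tauto) ltac:(tauto)).
    specialize (Hpos (Nat.max (depth c1) (depth c2))); lia.
  - specialize (Htwo c1 c2 ltac:(tauto) ltac:(tauto)).
    specialize (Hpos (Nat.max (depth c1) (depth c2))); lia.
  - rewrite Nat.ltb_lt in Hw; specialize (IHc ltac:(tauto)); specialize (HP q ltac:(tauto)).
    specialize (Hpos (depth c)).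
    assert (P q * (5 + cost P c) <= Y * ((5 + csize c) * Y ^ depth c)).
    { apply Nat.mul_le_mono; auto; lia. }
    nia.
Qed.

(** * Finite sums and row-major indexing *)

Fixpoint rsum (n : nat) (f : nat -> R) : R :=
  match n with 0 => 0%R | S k => (rsum k f + f k)%R end.

Fixpoint nsum (n : nat) (f : nat -> nat) : nat :=
  match n with 0 => 0 | S k => nsum k f + f k end.

Lemma rsum_ext n f g : (forall x, x < n -> f x = g x) -> rsum n f = rsum n g.
Proof. induction n; simpl; intros H; auto; rewrite IHn, H; auto. Qed.

Lemma rsum_le n f g : (forall x, x < n -> (f x <= g x)%R) -> (rsum n f <= rsum n g)%R.
Proof.
  induction n; simpl; intros H; [lra|].
  specialize (IHn ltac:(auto)); specialize (H n ltac:(auto)); lra.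
Qed.

Lemma rsum_0 n f : (forall x, x < n -> f x = 0%R) -> rsum n f = 0%R.
Proof. induction n; simpl; intros H; auto; rewrite IHn, H by auto; lra. Qed.

Lemma rsum_at n u f g :
  u < n -> (forall x, x < n -> x <> u -> g x = f x) ->
  rsum n g = (rsum n f + (g u - f u))%R.
Proof.
  induction n; simpl; intros Hu H; [lia|].
  destruct (Nat.eq_dec u n) as [->|Hn].
  - rewrite (rsum_ext n g f); [lra|]; intros; apply H; lia.
  - rewrite IHn, (H n) by (auto; lia); lra.
Qed.

Lemma nsum_ext n f g : (forall x, x < n -> f x = g x) -> nsum n f = nsum n g.
Proof. induction n; simpl; intros H; auto; rewrite IHn, H; auto. Qed.

Lemma nsum_upd_S n u f : u < n -> nsum n (upd f u (f u + 1)) = nsum n f + 1.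
Proof.
  induction n; simpl; intros Hu; [lia|].
  destruct (Nat.eq_dec u n) as [->|Hn].
  - rewrite upd_eq, (nsum_ext n _ f); [lia|]; intros; apply upd_neq; lia.
  - rewrite upd_neq, IHn by lia; lia.
Qed.

Lemma nsum_le n f b : (forall x, x < n -> f x <= b) -> nsum n f <= n * b.
Proof.
  induction n; simpl; intros H; auto.
  specialize (IHn ltac:(auto)); specialize (H n ltac:(auto)); lia.
Qed.

Lemma idx_inj M u v x y : v < M -> y < M -> u * M + v = x * M + y -> u = x /\ v = y.
Proof.
  intros Hv Hy H.
  assert (u = x); [|subst; lia].
  rewrite (Nat.div_unique (u * M + v) M u v), H by lia.
  symmetry; apply Nat.div_unique with y; lia.
Qed.

Lemma upd_idx {T : Type} M (F : nat -> T) u v z x y : v < M -> y < M ->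
  upd F (u * M + v)%nat z (x * M + y) = if (x =? u) && (y =? v) then z else F (x * M + y)%nat.
Proof.
  intros Hv Hy; unfold upd.
  destruct (Nat.eqb_spec (x * M + y) (u * M + v)) as [E|E].
  - apply idx_inj in E as [-> ->]; auto; now rewrite !Nat.eqb_refl.
  - destruct (Nat.eqb_spec x u), (Nat.eqb_spec y v); simpl; auto; subst; tauto.
Qed.

(** * Push-relabel for maximum-weight closures *)

(* [pF st (u * M + v)] is the flow on the arc u -> v, [pE] the excess, [pD] the label. *)
Record pst : Type := mkP { pF : nat -> R; pE : nat -> R; pD : nat -> nat }.

(** The second update reads the excess after the first one, in the order of the machine code; the
    two then agree without a case distinction on [u = v]. *)
Definition move (E : nat -> R) (u v : nat) (dl : R) : nat -> R :=
  upd (upd E u (E u - dl)%R) v (upd E u (E u - dl)%R v + dl)%R.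

(** An arc has infinite capacity, so a push along it empties [u]. Without an arc, only flow on
    [v -> u] can be cancelled, up to the excess of [u]. The test [pD st v <? M] retires nodes that
    have reached label [M + 1]. *)
Definition push (M : nat) (A : nat -> nat) (u v : nat) (st : pst) : pst :=
  if (pD st u =? pD st v + 1) && (pD st v <? M) then
    if Rle_dec (pE st u) 0 then st
    else if A (u * M + v) =? 0 then
      let x := pF st (v * M + u) in
      let dl := if Rle_dec x (pE st u) then x else pE st u in
      mkP (upd (pF st) (v * M + u) (x - dl)%R) (move (pE st) u v dl) (pD st)
    else
      mkP (upd (pF st) (u * M + v) (pF st (u * M + v) + pE st u)%R)
          (move (pE st) u v (pE st u)) (pD st)
  else st.

Fixpoint iterk {T : Type} (f : nat -> T -> T) (k : nat) (st : T) : T :=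
  match k with 0 => st | S k' => f k' (iterk f k' st) end.

Definition scan (M : nat) (A : nat -> nat) (u : nat) (st : pst) : pst :=
  iterk (push M A u) M st.

Definition relabel (M u : nat) (st : pst) : pst :=
  if Rle_dec (pE st u) 0 then st
  else if pD st u <=? M then mkP (pF st) (pE st) (upd (pD st) u (pD st u + 1))
  else st.

Definition disch (M : nat) (A : nat -> nat) (u : nat) (st : pst) : pst :=
  relabel M u (scan M A u st).

Definition pass (M : nat) (A : nat -> nat) (st : pst) : pst :=
  iterk (disch M A) M st.

Definition res (M : nat) (A : nat -> nat) (st : pst) (u v : nat) : Prop :=
  A (u * M + v) <> 0 \/ (0 < pF st (v * M + u))%R.

(** The flow paired with the differences of a potential [c]. For the indicator of a set this is the
    net flow into the set. *)
Definition netflow (M : nat) (F : nat -> R) (c : nat -> R) : R :=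
  rsum M (fun u => rsum M (fun x => F (u * M + x)%nat * (c x - c u))%R).

(** Conservation [i_cons] is stated against all potentials [c]: a push then changes both sides by
    one explicit term, and indicators give the balance of a set at once. [i_lab] is validity of the
    labelling on residual arcs, and [i_neg] keeps deficits at the bottom level. *)
Record inv (M : nat) (A : nat -> nat) (ww : nat -> R) (st : pst) : Prop := mkInv {
  i_pos : forall u v, u < M -> v < M -> (0 <= pF st (u * M + v))%R;
  i_arc : forall u v, u < M -> v < M -> (0 < pF st (u * M + v))%R -> A (u * M + v) <> 0;
  i_cons : forall c : nat -> R, rsum M (fun x => c x * pE st x)%R =
             (rsum M (fun x => c x * ww x) + netflow M (pF st) c)%R;
  i_neg : forall v, v < M -> (pE st v < 0)%R -> pD st v = 0;
  i_lab : forall u v, u < M -> v < M -> res M A st u v -> pD st u <= pD st v + 1;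
  i_cap : forall v, v < M -> pD st v <= M + 1
}.

Lemma netflow_upd M F c a b th : a < M -> b < M ->
  netflow M (upd F (a * M + b)%nat (F (a * M + b)%nat + th)%R) c =
  (netflow M F c + th * (c b - c a))%R.
Proof.
  intros Ha Hb; unfold netflow; set (F' := upd F _ _).
  rewrite (rsum_at M a (fun u => rsum M (fun x => F (u * M + x)%nat * (c x - c u))%R)
    (fun u => rsum M (fun x => F' (u * M + x)%nat * (c x - c u))%R)); auto.
  - rewrite (rsum_at M b (fun x => F (a * M + x)%nat * (c x - c a))%R
      (fun x => F' (a * M + x)%nat * (c x - c a))%R); auto.
    + unfold F'; rewrite upd_eq; ring.
    + intros x Hx Hxb; unfold F'; rewrite upd_idx; auto.
      destruct (Nat.eqb_spec x b); [tauto|]; now rewrite andb_false_r.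
  - intros x Hx Hxa; apply rsum_ext; intros y Hy; unfold F'; rewrite upd_idx; auto.
    destruct (Nat.eqb_spec x a); [tauto|]; reflexivity.
Qed.

Lemma rsum_move M c E u v dl : u < M -> v < M ->
  rsum M (fun x => c x * move E u v dl x)%R =
  (rsum M (fun x => c x * E x) + dl * (c v - c u))%R.
Proof.
  intros Hu Hv; unfold move; set (E1 := upd E u _).
  rewrite (rsum_at M v (fun x => c x * E1 x)%R (fun x => c x * upd E1 v (E1 v + dl) x)%R); auto.
  2:{ intros x Hx Hn; rewrite upd_neq; auto. }
  rewrite (rsum_at M u (fun x => c x * E x)%R (fun x => c x * E1 x)%R); auto.
  2:{ intros x Hx Hn; unfold E1; rewrite upd_neq; auto. }
  rewrite upd_eq; replace (E1 u) with (E u - dl)%R by (unfold E1; now rewrite upd_eq); ring.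
Qed.

(* [th] is the signed change of the flow on the arc [a -> b]. *)
Lemma push_cases M A u v st :
  (push M A u v st = st /\
     ((0 < pE st u)%R -> pD st u = pD st v + 1 -> M <= pD st v)) \/
  (pD st u = pD st v + 1 /\ pD st v < M /\ (0 < pE st u)%R /\
   exists dl a b th, (dl <= pE st u)%R /\
     push M A u v st = mkP (upd (pF st) (a * M + b) (pF st (a * M + b) + th)%R)
                           (move (pE st) u v dl) (pD st) /\
     ((A (u * M + v) <> 0 /\ a = u /\ b = v /\ th = dl /\ dl = pE st u) \/
      (A (u * M + v) = 0 /\ a = v /\ b = u /\ th = (- dl)%R /\
       (dl = pE st u /\ pE st u <= pF st (v * M + u) \/ dl = pF st (v * M + u))%R))).
Proof.
  unfold push.
  destruct (Nat.eqb_spec (pD st u) (pD st v + 1)) as [E|E]; simpl; [|left; split; auto; tauto].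
  destruct (Nat.ltb_spec (pD st v) M) as [L|L]; [|left; split; auto].
  destruct (Rle_dec (pE st u) 0) as [P|P]; [left; split; auto; lra|].
  right; repeat split; auto; [lra|].
  destruct (Nat.eqb_spec (A (u * M + v)) 0) as [Z|Z].
  - destruct Rle_dec as [Q|Q]; do 4 eexists; (split; [|split; [reflexivity|right; repeat split; auto]]);
      try lra; left; split; auto; lra.
  - exists (pE st u), u, v, (pE st u); split; [lra|]; split; auto.
    left; auto.
Qed.

Lemma move_src E u v dl : u <> v -> move E u v dl u = (E u - dl)%R.
Proof. intros H; unfold move; rewrite upd_neq, upd_eq; auto. Qed.
Lemma move_dst E u v dl : u <> v -> move E u v dl v = (E v + dl)%R.
Proof. intros H; unfold move; rewrite upd_eq, upd_neq; auto. Qed.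
Lemma move_oth E u v dl x : x <> u -> x <> v -> move E u v dl x = E x.
Proof. intros; unfold move; rewrite !upd_neq; auto. Qed.

Lemma push_D M A u v st : pD (push M A u v st) = pD st.
Proof.
  destruct (push_cases M A u v st) as [[-> _]|(_ & _ & _ & dl & a & b & th & _ & -> & _)];
    auto.
Qed.

(** The only residual arc that a push can create is [v -> u], which climbs one level and so respects
    [i_lab]. No new deficit arises, since at most the excess of [u] is moved. *)
Lemma push_inv M A ww u v st : u < M -> v < M ->
  inv M A ww st -> inv M A ww (push M A u v st).
Proof.
  intros Hu Hv I.
  destruct (push_cases M A u v st) as
    [[-> _]|(HD & HM & HE & dl & a & b & th & Hdl & -> & Hc)]; auto.
  assert (Huv : u <> v) by (intros ->; lia).
  assert (Ha : a < M) by (destruct Hc as [Hc|Hc]; decompose [and] Hc; subst; auto).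
  assert (Hb : b < M) by (destruct Hc as [Hc|Hc]; decompose [and] Hc; subst; auto).
  assert (Hpos : (0 <= dl)%R).
  { pose proof (i_pos _ _ _ _ I v u Hv Hu).
    destruct Hc as [(_ & _ & _ & _ & ->)|(_ & _ & _ & _ & [[-> _]| ->])]; lra. }
  assert (Hth : (0 <= pF st (a * M + b) + th)%R).
  { pose proof (i_pos _ _ _ _ I a b Ha Hb).
    destruct Hc as [(_ & -> & -> & -> & _)|(_ & -> & -> & -> & [[-> ?]| ->])]; lra. }
  split; simpl.
  - intros x y Hx Hy; rewrite upd_idx; auto.
    destruct andb; auto; now apply (i_pos _ _ _ _ I).
  - intros x y Hx Hy; rewrite upd_idx; auto.
    destruct (Nat.eqb_spec x a) as [->|]; [destruct (Nat.eqb_spec y b) as [->|]|];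
      simpl; try (now apply (i_arc _ _ _ _ I)).
    intros Hp; destruct Hc as [(? & -> & -> & _)|(_ & -> & -> & -> & _)]; auto.
    apply (i_arc _ _ _ _ I); auto; lra.
  - intros c; rewrite rsum_move, netflow_upd, (i_cons _ _ _ _ I); auto.
    destruct Hc as [(_ & -> & -> & -> & _)|(_ & -> & -> & -> & _)]; ring.
  - intros x Hx Hn; apply (i_neg _ _ _ _ I); auto.
    destruct (Nat.eq_dec x u) as [->|Hxu]; [rewrite move_src in Hn; auto; lra|].
    destruct (Nat.eq_dec x v) as [->|Hxv]; [rewrite move_dst in Hn; auto; lra|].
    rewrite move_oth in Hn; auto.
  - unfold res; simpl; intros x y Hx Hy Hr.
    destruct (Nat.eq_dec (pD st x) (pD st y + 1)) as [|Hne]; [lia|].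
    destruct Hr as [Hr|Hr]; [now apply (i_lab _ _ _ _ I); auto; left|].
    rewrite upd_idx in Hr; auto.
    destruct (Nat.eqb_spec y a) as [->|]; [destruct (Nat.eqb_spec x b) as [->|]|];
      simpl in Hr; try (apply (i_lab _ _ _ _ I); auto; now right).
    destruct Hc as [(_ & -> & -> & -> & _)|(_ & -> & -> & -> & _)]; [lia|].
    apply (i_lab _ _ _ _ I); auto; right; lra.
  - apply (i_cap _ _ _ _ I).
Qed.

(** If excess is left at [u] after treating [v], the push was limited by the residual capacity and
    has exhausted it. Later pushes out of [u] create no residual arc out of [u] and change no label,
    so this persists. *)
Lemma scan_spec M A ww u st k : u < M -> k <= M -> inv M A ww st ->
  let st' := iterk (push M A u) k st in
  inv M A ww st' /\ pD st' = pD st /\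
  ((0 < pE st' u)%R -> forall v, v < k -> pD st u = pD st v + 1 -> pD st v < M ->
     ~ res M A st' u v).
Proof.
  intros Hu; induction k; simpl; intros Hk I.
  - repeat split; auto; try apply I; intros; lia.
  - destruct IHk as (I' & D' & R'); auto; [lia|].
    set (st1 := iterk (push M A u) k st) in *.
    split; [apply push_inv; auto; lia|].
    rewrite push_D; split; auto.
    pose proof (i_pos _ _ _ _ I' k u ltac:(lia) Hu) as Hp.
    destruct (push_cases M A u k st1) as
      [[-> HX]|(HD & HM & HE & dl & a & b & th & Hdl & -> & Hc)].
    + intros He v Hv Ev Lv.
      destruct (Nat.eq_dec v k) as [->|]; [|apply R'; auto; lia].
      rewrite D' in HX; specialize (HX He Ev); lia.
    + assert (Huk : u <> k) by (intros ->; lia).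
      simpl; rewrite move_src by auto; intros He v Hv Ev Lv Hr.
      (* A push along an arc would have emptied [u]; hence flow on [k -> u] was cancelled, and all
         of it. *)
      destruct Hc as [(_ & _ & _ & _ & ->)|(HA & -> & -> & -> & Hdl')]; [lra|].
      assert (dl = pF st1 (k * M + u)) by (destruct Hdl' as [[-> _]|]; [lra|auto]); subst dl.
      clear Hdl'.
      destruct Hr as [Hr|Hr]; simpl in Hr.
      * destruct (Nat.eq_dec v k) as [->|]; [auto|].
        apply (R' ltac:(lra) v); auto; [lia|now left].
      * rewrite upd_idx in Hr; auto.
        destruct (Nat.eqb_spec v k) as [->|].
        -- rewrite Nat.eqb_refl in Hr; simpl in Hr; lra.
        -- simpl in Hr; apply (R' ltac:(lra) v); auto; [lia|now right].
Qed.

(** Raising [u] by one could only violate validity on a residual arc to the level just below [u],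
    and after the scan none remains. A raised node has positive excess, so [i_neg] is unaffected. *)
Lemma disch_inv M A ww u st : u < M -> inv M A ww st -> inv M A ww (disch M A u st).
Proof.
  intros Hu I; destruct (scan_spec M A ww u st M Hu (le_n M) I) as (I' & D' & R').
  unfold disch, scan; set (st1 := iterk (push M A u) M st) in *.
  unfold relabel; destruct Rle_dec as [|He]; auto.
  destruct (Nat.leb_spec (pD st1 u) M) as [HD|]; auto.
  destruct I' as [I1 I2 I3 I4 I5 I6]; split; simpl; auto.
  - intros v Hv Hn; rewrite upd_neq; auto; intros ->; lra.
  - intros x y Hx Hy Hr.
    assert (Hr' : res M A st1 x y) by exact Hr.
    specialize (I5 x y Hx Hy Hr'); unfold upd.
    destruct (Nat.eqb_spec x u) as [->|], (Nat.eqb_spec y u) as [->|]; try lia.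
    assert (pD st1 u <> pD st1 y + 1); [|lia].
    rewrite D' in *; intros E; apply (R' ltac:(lra) y); auto; lia.
  - intros v Hv; specialize (I6 v Hv); unfold upd.
    destruct (Nat.eqb_spec v u) as [->|]; lia.
Qed.

Lemma pass_inv M A ww st : inv M A ww st -> inv M A ww (pass M A st).
Proof.
  intros I; unfold pass; assert (forall k, k <= M -> inv M A ww (iterk (disch M A) k st)); auto.
  induction k; simpl; auto; intros; apply disch_inv; auto; apply IHk; lia.
Qed.

(** * Bounding the number of rounds *)

Definition active (M : nat) (st : pst) (x : nat) : Prop :=
  (0 < pE st x)%R /\ pD st x <= M.

Lemma push_active M A u v st x : u < M -> v < M ->
  active M (push M A u v st) x ->
  active M st x \/ (pD st u = pD st x + 1 /\ active M st u).
Proof.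
  intros Hu Hv [He Hd]; rewrite push_D in Hd; unfold active.
  destruct (push_cases M A u v st) as
    [[E _]|(HD & HM & HE & dl & a & b & th & Hdl & E & Hc)]; rewrite E in He; auto.
  assert (Huv : u <> v) by (intros ->; lia); simpl in He.
  destruct (Nat.eq_dec x v) as [->|Hxv]; [right; repeat split; auto; lia|].
  destruct (Nat.eq_dec x u) as [->|Hxu]; [left; auto|].
  rewrite move_oth in He; auto.
Qed.

(* [L] strictly bounds the labels of the active nodes.  A round without any
   relabelling pushes all excess at least one level down. *)
Lemma pass_progress M A st L :
  (forall x, x < M -> active M st x -> pD st x < L) ->
  (0 < L /\ nsum M (pD st) + 1 <= nsum M (pD (pass M A st))) \/
  (nsum M (pD (pass M A st)) = nsum M (pD st) /\
   forall x, x < M -> active M (pass M A st) x -> pD (pass M A st) x + 1 < L).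
Proof.
  intros H0; unfold pass.
  (* A node already discharged in this round can be active again only through excess from a node one
     level higher, whence the stronger bound for [x < k]. *)
  assert (HJ : forall k, k <= M -> let st' := iterk (disch M A) k st in
    (0 < L /\ nsum M (pD st) + 1 <= nsum M (pD st')) \/
    (nsum M (pD st') = nsum M (pD st) /\
     forall x, x < M -> active M st' x -> pD st' x < L /\ (x < k -> pD st' x + 1 < L))).
  2:{ destruct (HJ M (le_n M)) as [|[E J]]; [now left|right; split; auto].
      intros x Hx Ha; now apply J. }
  induction k; simpl; intros Hk.
  { right; split; auto; intros x Hx Ha; split; auto; lia. }
  specialize (IHk ltac:(lia)); set (st1 := iterk (disch M A) k st) in *.
  unfold disch, scan.
  assert (HS : forall j, j <= M -> let st' := iterk (push M A k) j st1 in
    pD st' = pD st1 /\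
    ((forall x, x < M -> active M st1 x -> pD st1 x < L /\ (x < k -> pD st1 x + 1 < L)) ->
     forall x, x < M -> active M st' x -> pD st1 x < L /\ (x < k -> pD st1 x + 1 < L))).
  { induction j; simpl; intros Hj; [auto|].
    destruct (IHj ltac:(lia)) as [D' J']; rewrite push_D; split; auto.
    intros J x Hx Ha; apply push_active in Ha; [|lia|lia].
    rewrite D' in Ha; destruct Ha as [Ha|[E Ha]]; [now apply J'|].
    specialize (J' J k ltac:(lia) Ha); lia. }
  destruct (HS M (le_n M)) as [D2 J2]; set (st2 := iterk (push M A k) M st1) in *.
  unfold relabel; destruct Rle_dec as [He|He]; [|destruct (Nat.leb_spec (pD st2 k) M)].
  - rewrite D2; destruct IHk as [|[E J]]; [now left|right; split; auto].
    intros x Hx Ha; destruct (J2 J x Hx Ha) as [B1 B2]; split; auto.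
    intros Hxk; destruct (Nat.eq_dec x k) as [->|]; [|apply B2; lia].
    destruct Ha; lra.
  - left; simpl; rewrite nsum_upd_S by lia; rewrite D2.
    destruct IHk as [|[E J]]; [lia|].
    destruct (J2 J k ltac:(lia)) as [B1 _]; [split; auto; lra|lia].
  - rewrite D2; destruct IHk as [|[E J]]; [now left|right; split; auto].
    intros x Hx Ha; destruct (J2 J x Hx Ha) as [B1 B2]; split; auto.
    intros Hxk; destruct (Nat.eq_dec x k) as [->|]; [|apply B2; lia].
    destruct Ha; lia.
Qed.

Lemma passes_inv M A ww st T : inv M A ww st ->
  inv M A ww (iterk (fun _ => pass M A) T st).
Proof. intros I; induction T; simpl; auto using pass_inv. Qed.

(** While [L] is positive, the number of rounds is at most the potential
    [nsum M D * (M + 2) + (M + 1 - L)]. A relabelling round gains at least [M + 2] and resets [L] to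
    [M + 1]; any other round lowers [L]. As the labels sum to at most [M * (M + 1)], the potential
    stays within [(M + 1)^3]. *)
Lemma passes_quiet M A ww st T : inv M A ww st -> (M + 2) * (M + 2) * (M + 2) <= T ->
  forall x, x < M -> ~ active M (iterk (fun _ => pass M A) T st) x.
Proof.
  intros I HT.
  assert (H : forall k, exists L, L <= M + 1 /\
    let st' := iterk (fun _ => pass M A) k st in
    (forall x, x < M -> active M st' x -> pD st' x < L) /\
    (L = 0 \/ k <= nsum M (pD st') * (M + 2) + (M + 1 - L))).
  { induction k as [|k (L & HL & J & B)].
    - exists (M + 1); split; auto; simpl; split; [|lia]; intros x Hx [_ Hd]; lia.
    - simpl; set (st1 := iterk _ k st) in *.
      destruct (pass_progress M A st1 L J) as [[HL0 HD]|[HD HA]].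
      + exists (M + 1); split; auto; split; [intros x Hx [_ Hd]; lia|].
        right; destruct B as [->|B]; [lia|nia].
      + exists (L - 1); split; [lia|]; split.
        * intros x Hx Ha; specialize (HA x Hx Ha); lia.
        * rewrite HD; lia. }
  destruct (H T) as (L & HL & J & B).
  intros x Hx Ha; specialize (J x Hx Ha); destruct B as [->|B]; [lia|].
  pose proof (nsum_le M (pD (iterk (fun _ => pass M A) T st)) (M + 1)
    (i_cap _ _ _ _ (passes_inv M A ww st T I))).
  nia.
Qed.

Lemma init_inv M A ww st :
  (forall u v, u < M -> v < M -> pF st (u * M + v) = 0%R) ->
  (forall x, x < M -> pE st x = ww x) -> (forall x, x < M -> pD st x = 0) ->
  inv M A ww st.
Proof.
  intros HF HE HD; split.
  - intros; rewrite HF; auto; lra.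
  - intros u v Hu Hv; rewrite HF; auto; lra.
  - intros c; unfold netflow.
    rewrite (rsum_0 M (fun u => rsum M _)).
    + rewrite Rplus_0_r; apply rsum_ext; intros; rewrite HE; auto.
    + intros u Hu; apply rsum_0; intros x Hx; rewrite HF; auto; ring.
  - auto.
  - intros; rewrite !HD; auto; lia.
  - intros; rewrite HD; auto; lia.
Qed.

(** * Optimality of the nodes above an empty level *)

Definition succ_closed (M : nat) (A : nat -> nat) (C : nat -> bool) : Prop :=
  forall u v, u < M -> v < M -> A (u * M + v) <> 0 -> C u = true -> C v = true.

Definition wsum (M : nat) (ww : nat -> R) (C : nat -> bool) : R :=
  rsum M (fun x => if C x then ww x else 0%R).

(* An empty label level separates the nodes that can still send excess to a
   deficit from those that cannot. *)
Lemma gap_closed M A ww st g : inv M A ww st -> (forall x, x < M -> pD st x <> g) ->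
  succ_closed M A (fun x => g <=? pD st x).
Proof.
  intros I Hg u v Hu Hv HA; rewrite !Nat.leb_le; intros H.
  pose proof (i_lab _ _ _ _ I u v Hu Hv ltac:(now left)); specialize (Hg u Hu); lia.
Qed.

(** Weak duality: no flow leaves a closed set, so its weight is at most its total excess. For the
    set above the gap equality holds, since an arc carrying flow is residual both ways, its end
    labels differ by at most one, and it cannot straddle the gap. Excess is nonnegative above the
    gap and nonpositive below it, so this set has the largest total excess. *)
Lemma gap_optimal M A ww st g C : inv M A ww st ->
  (forall x, x < M -> ~ active M st x) -> 1 <= g <= M + 1 ->
  (forall x, x < M -> pD st x <> g) -> succ_closed M A C ->
  (wsum M ww C <= wsum M ww (fun x => g <=? pD st x))%R.
Proof.
  intros I Hq Hg Hgap HC.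
  set (ind := fun (C : nat -> bool) x => if C x then 1%R else 0%R).
  assert (Hw : forall C, wsum M ww C = rsum M (fun x => ind C x * ww x)%R).
  { intros C'; apply rsum_ext; intros; unfold ind; destruct C'; lra. }
  set (S := fun x => g <=? pD st x).
  pose proof (i_cons _ _ _ _ I (ind C)) as E1; rewrite <- Hw in E1.
  pose proof (i_cons _ _ _ _ I (ind S)) as E2; rewrite <- Hw in E2.
  assert (N1 : (0 <= netflow M (pF st) (ind C))%R).
  { unfold netflow; rewrite <- (rsum_0 M (fun _ => 0%R)) by auto.
    apply rsum_le; intros u Hu; rewrite <- (rsum_0 M (fun _ => 0%R)) by auto.
    apply rsum_le; intros v Hv.
    pose proof (i_pos _ _ _ _ I u v Hu Hv).
    destruct (Req_dec (pF st (u * M + v)) 0) as [->|]; [lra|].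
    pose proof (i_arc _ _ _ _ I u v Hu Hv ltac:(lra)) as HA.
    specialize (HC u v Hu Hv HA); unfold ind.
    destruct (C u), (C v); try (discriminate (HC eq_refl)); nra. }
  assert (N2 : netflow M (pF st) (ind S) = 0%R).
  { apply rsum_0; intros u Hu; apply rsum_0; intros v Hv.
    pose proof (i_pos _ _ _ _ I u v Hu Hv).
    destruct (Req_dec (pF st (u * M + v)) 0) as [->|]; [lra|].
    pose proof (i_arc _ _ _ _ I u v Hu Hv ltac:(lra)) as HA.
    pose proof (i_lab _ _ _ _ I u v Hu Hv ltac:(now left)).
    pose proof (i_lab _ _ _ _ I v u Hv Hu ltac:(right; lra)).
    pose proof (Hgap u Hu); pose proof (Hgap v Hv).
    unfold ind, S.
    destruct (Nat.leb_spec g (pD st u)), (Nat.leb_spec g (pD st v)); try lia; ring. }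
  assert (L : (rsum M (fun x => ind C x * pE st x) <= rsum M (fun x => ind S x * pE st x))%R).
  { apply rsum_le; intros x Hx.
    pose proof (i_cap _ _ _ _ I x Hx).
    unfold ind, S; destruct (Nat.leb_spec g (pD st x)).
    - assert (0 <= pE st x)%R.
      { destruct (Rlt_le_dec (pE st x) 0) as [Hn|]; auto.
        apply (i_neg _ _ _ _ I) in Hn; auto; lia. }
      destruct (C x); lra.
    - assert (pE st x <= 0)%R.
      { destruct (Rlt_le_dec 0 (pE st x)) as [Hn|]; auto.
        exfalso; apply (Hq x Hx); split; auto; lia. }
      destruct (C x); lra. }
  lra.
Qed.

(** Pigeonhole: [M] nodes cannot occupy [M + 1] levels. The program can therefore fall back on level
    [M + 1] without testing it. *)
Lemma top_level_empty M (D : nat -> nat) :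
  (forall g, 1 <= g <= M -> exists x, x < M /\ D x = g) ->
  forall x, x < M -> D x <> M + 1.
Proof.
  intros H x Hx Hd.
  assert (HI : incl (seq 1 (M + 1)) (map D (seq 0 M))).
  { intros g Hg; apply in_seq in Hg; apply in_map_iff.
    destruct (Nat.eq_dec g (M + 1)) as [->|].
    - exists x; split; auto; apply in_seq; lia.
    - destruct (H g ltac:(lia)) as (y & Hy & E); exists y; split; auto; apply in_seq; lia. }
  apply NoDup_incl_length in HI; [|apply seq_NoDup].
  rewrite length_map, !length_seq in HI; lia.
Qed.

(** * Feasible sets as closed sets *)

Lemma adj_sym E u v : adj E u v -> adj E v u.
Proof. unfold adj; tauto. Qed.

Definition adjb (E : list (nat * nat)) (u v : nat) : bool :=
  existsb (fun e => ((fst e =? u) && (snd e =? v)) || ((fst e =? v) && (snd e =? u))) E.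

Lemma adjb_spec E u v : adjb E u v = true <-> adj E u v.
Proof.
  unfold adjb, adj; rewrite existsb_exists; split.
  - intros [[a b] [H1 H2]]; simpl in H2.
    rewrite orb_true_iff, !andb_true_iff, !Nat.eqb_eq in H2.
    destruct H2 as [[-> ->]|[-> ->]]; auto.
  - intros [H|H]; eexists; (split; [exact H|]); simpl;
      rewrite !Nat.eqb_refl; simpl; auto using orb_true_r.
Qed.

Lemma adjb_false E u v : adjb E u v = false <-> ~ adj E u v.
Proof. rewrite <- adjb_spec; destruct adjb; split; congruence. Qed.

(* Node [n] is a dummy; [i0 = n] encodes the feasible sets containing all
   [I]-neighbours of their clique vertices, [i0 < n] those for which the single
   exception is [i0].  A nonempty closed set contains [i0], which stands for the
   obligation to contain every clique vertex not adjacent to [i0]. *)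
Definition arcb (n : nat) (inK : nat -> bool) (E : list (nat * nat)) (i0 u v : nat) : bool :=
  if v =? i0 then true
  else if u =? i0 then (i0 <? n) && ((v <? n) && inK v) && negb (adjb E i0 v)
  else ((u <? n) && inK u) && negb ((v <? n) && inK v) && adjb E u v.

(** Neither the exception nor the dummy belongs to the feasible set encoded, so both weigh
    nothing. *)
Definition wt (n : nat) (w : nat -> R) (i0 x : nat) : R :=
  if (x =? i0) || (x =? n) then 0%R else w x.

Definition arc_closed (n : nat) (inK : nat -> bool) (E : list (nat * nat)) (i0 : nat)
    (C : nat -> bool) : Prop :=
  forall u v, u <= n -> v <= n -> arcb n inK E i0 u v = true -> C u = true -> C v = true.

Lemma simplicial_mono n E S S' x :
  simplicial_in n E S x -> incl S S' -> ~ In x S' -> simplicial_in n E S' x.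
Proof.
  intros (H1 & H2 & H3) HI Hx; split; [auto|split; auto].
Qed.

(** Deletions keep the remaining vertices simplicial, so a batch of simultaneously simplicial
    vertices can be shelled in any order. *)
Lemma shelling_of_simplicial n E l : forall S, NoDup l ->
  (forall x, In x l -> simplicial_in n E S x) -> shelling_from n E S l.
Proof.
  induction l as [|a l IH]; intros S Hd H; simpl; auto.
  inversion Hd; subst; split; [apply H; now left|].
  apply IH; auto; intros x Hx.
  apply simplicial_mono with S; auto.
  - apply H; now right.
  - now apply incl_tl, incl_refl.
  - intros [->|Hs]; [auto|]; destruct (H x ltac:(now right)) as (_ & N & _); auto.
Qed.

Lemma shelling_app n E l1 : forall S l2,
  shelling_from n E S (l1 ++ l2) <->
  shelling_from n E S l1 /\ shelling_from n E (rev l1 ++ S) l2.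
Proof.
  induction l1 as [|a l1 IH]; intros S l2; simpl; [tauto|].
  rewrite IH, <- app_assoc; simpl; tauto.
Qed.

Lemma shelling_split n E s1 x s2 :
  shelling_from n E [] (s1 ++ x :: s2) -> simplicial_in n E (rev s1) x.
Proof. rewrite shelling_app, app_nil_r; simpl; tauto. Qed.

Lemma shelling_nodup n E s : forall S, shelling_from n E S s ->
  NoDup s /\ (forall x, In x s -> x < n /\ ~ In x S).
Proof.
  induction s as [|a s IH]; intros S; simpl.
  - intros _; split; [constructor|tauto].
  - intros [(H1 & H2 & _) H3]; apply IH in H3 as [H3 H4]; split.
    + constructor; auto; intros Hin; destruct (H4 a Hin) as [_ N]; apply N; now left.
    + intros x [<-|Hx]; auto; destruct (H4 x Hx) as [L N]; split; auto.
      intros HS; apply N; now right.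
Qed.

Lemma weight_app w l1 l2 : weight w (l1 ++ l2) = (weight w l1 + weight w l2)%R.
Proof.
  unfold weight; induction l1; simpl; [ring|]; rewrite IHl1; ring.
Qed.

Lemma weight_filter w P n :
  weight w (filter P (seq 0 n)) = rsum n (fun x => if P x then w x else 0%R).
Proof.
  induction n; [reflexivity|].
  rewrite seq_S, filter_app, weight_app, IHn; simpl.
  destruct (P n); unfold weight; simpl; ring.
Qed.

(** * The two directions of the characterization *)

Definition memb (x : nat) (s : list nat) : bool := existsb (Nat.eqb x) s.

Lemma memb_spec x s : memb x s = true <-> In x s.
Proof.
  unfold memb; rewrite existsb_exists; split.
  - intros (y & H & E); apply Nat.eqb_eq in E; now subst.
  - intros H; exists x; split; auto; apply Nat.eqb_refl.
Qed.

Lemma weight_memb w n s : NoDup s -> (forall x, In x s -> x < n) ->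
  rsum n (fun x => if memb x s then w x else 0%R) = weight w s.
Proof.
  induction s as [|a s IH]; intros Hd Hn.
  - apply rsum_0; auto.
  - inversion Hd; subst.
    rewrite (rsum_at n a (fun x => if memb x s then w x else 0%R)).
    + rewrite IH; auto; [|intros; apply Hn; now right].
      simpl; rewrite Nat.eqb_refl; simpl.
      destruct (memb a s) eqn:Em; [apply memb_spec in Em; tauto|].
      unfold weight; simpl; ring.
    + apply Hn; now left.
    + intros x Hx Hxa; simpl; destruct (Nat.eqb_spec x a); [tauto|reflexivity].
Qed.

(** The shelling consists of three batches. Vertices of [I] are always simplicial. Then the clique
    vertices not adjacent to [i0] have only clique neighbours left. Once these are gone, each
    remaining clique vertex of [C] sees only [i0] and clique vertices adjacent to [i0], which form a
    clique. *)
Lemma shelling_of_closed n inK E w i0 C :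
  is_split_graph n inK E -> i0 <= n -> (i0 < n -> inK i0 = false) ->
  arc_closed n inK E i0 C ->
  exists s, shelling_from n E [] s /\
    (forall v, In v s <-> v < n /\ v <> i0 /\ C v = true) /\
    weight w s = wsum (S n) (wt n w i0) C.
Proof.
  intros (HE & HK & HI) Hi0 HiI HC.
  set (P1 := fun x => C x && negb (x =? i0) && negb (inK x)).
  set (P2 := fun x => C x && inK x && negb (adjb E i0 x)).
  set (P3 := fun x => C x && inK x && adjb E i0 x).
  assert (S1 : forall x, P1 x = true <-> C x = true /\ x <> i0 /\ inK x = false).
  { intros x; unfold P1; rewrite !andb_true_iff, !negb_true_iff, Nat.eqb_neq; tauto. }
  assert (S2 : forall x, P2 x = true <-> C x = true /\ inK x = true /\ ~ adj E i0 x).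
  { intros x; unfold P2; rewrite !andb_true_iff, negb_true_iff, adjb_false; tauto. }
  assert (S3 : forall x, P3 x = true <-> C x = true /\ inK x = true /\ adj E i0 x).
  { intros x; unfold P3; rewrite !andb_true_iff, adjb_spec; tauto. }
  assert (In1 : forall P x, In x (filter P (seq 0 n)) <-> x < n /\ P x = true).
  { intros; rewrite filter_In, in_seq; split; intros [? ?]; split; auto; lia. }
  assert (Hni0 : forall x, x < n -> inK x = true -> x <> i0).
  { intros x Hx Hk ->; rewrite HiI in Hk; congruence. }
  assert (Ci0 : forall x, x < n -> C x = true -> C i0 = true).
  { intros x Hx Hc; apply (HC x i0); auto; [lia|]; unfold arcb; now rewrite Nat.eqb_refl. }
  assert (Cnb : forall k y, k < n -> y < n -> inK k = true -> inK y = false -> y <> i0 ->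
    adj E k y -> C k = true -> C y = true).
  { intros k y Hk Hy Kk Ky Hyi Ha; apply HC; try lia; unfold arcb.
    destruct (Nat.eqb_spec y i0); [tauto|].
    destruct (Nat.eqb_spec k i0) as [->|]; [exfalso; apply (Hni0 i0); auto|].
    apply adjb_spec in Ha; apply Nat.ltb_lt in Hk; apply Nat.ltb_lt in Hy.
    now rewrite Hk, Hy, Kk, Ky, Ha. }
  assert (CQ : forall x, i0 < n -> x < n -> inK x = true -> ~ adj E i0 x ->
    C i0 = true -> C x = true).
  { intros x Hi Hx Kx Ha; apply HC; try lia; unfold arcb.
    destruct (Nat.eqb_spec x i0); auto; rewrite Nat.eqb_refl.
    apply adjb_false in Ha; apply Nat.ltb_lt in Hi; apply Nat.ltb_lt in Hx.
    now rewrite Hi, Hx, Kx, Ha. }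
  set (l1 := filter P1 (seq 0 n)); set (l2 := filter P2 (seq 0 n));
    set (l3 := filter P3 (seq 0 n)).
  exists (l1 ++ l2 ++ l3); split; [|split].
  - rewrite !shelling_app; split; [|split]; apply shelling_of_simplicial;
      try (apply NoDup_filter, seq_NoDup).
    + intros x; unfold l1; rewrite In1, S1; intros (Hx & Hc & Hxi & Ix).
      split; [auto|split; [simpl; tauto|]].
      intros a b Ha Hb _ _ Hab Aa Ab.
      assert (KI : forall y, y < n -> adj E x y -> inK y = true).
      { intros y Hy Hxy; destruct (inK y) eqn:Ky; auto; exfalso; now apply (HI x y). }
      apply HK; auto.
    + intros x; unfold l2; rewrite In1, S2; intros (Hx & Hc & Kx & Nx).
      assert (In2 : forall y, In y (rev l1 ++ []) <-> y < n /\ P1 y = true).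
      { intros y; rewrite app_nil_r, <- in_rev; apply In1. }
      split; [auto|split].
      { rewrite In2, S1; intros (_ & _ & _ & ?); congruence. }
      intros a b Ha Hb; rewrite !In2, !S1; intros Na Nb Hab Aa Ab.
      assert (KI : forall y, y < n -> adj E x y ->
        ~ (y < n /\ C y = true /\ y <> i0 /\ inK y = false) -> inK y = true).
      { intros y Hy Hxy Ny; destruct (inK y) eqn:Ky; auto; exfalso; apply Ny.
        assert (y <> i0) by (intros ->; apply Nx; now apply adj_sym).
        repeat split; auto; now apply (Cnb x y). }
      apply HK; auto.
    + intros x; unfold l3; rewrite In1, S3; intros (Hx & Hc & Kx & Ax).
      (* For [i0 = n] the third batch is empty, because edges have both ends below [n]. *)
      assert (Hi : i0 < n).
      { destruct Ax as [Ax|Ax]; apply HE in Ax; tauto. }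
      assert (In3 : forall y, In y (rev l2 ++ rev l1 ++ []) <->
        y < n /\ (P1 y = true \/ P2 y = true)).
      { intros y; rewrite app_nil_r, in_app_iff, <- !in_rev; unfold l1, l2; rewrite !In1; tauto. }
      split; [auto|split].
      { rewrite In3, S1, S2; intros (_ & [(_ & _ & ?)|(_ & _ & ?)]); [congruence|tauto]. }
      intros a b Ha Hb; rewrite !In3, !S1, !S2; intros Na Nb Hab Aa Ab.
      assert (KI : forall y, y < n -> adj E x y ->
        ~ (y < n /\ ((C y = true /\ y <> i0 /\ inK y = false) \/
                     (C y = true /\ inK y = true /\ ~ adj E i0 y))) ->
        y = i0 \/ (inK y = true /\ adj E i0 y)).
      { intros y Hy Hxy Ny; destruct (Nat.eq_dec y i0) as [|Hyi]; auto; right.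
        destruct (inK y) eqn:Ky.
        - split; auto; destruct (adjb E i0 y) eqn:Eb; [now apply adjb_spec|].
          apply adjb_false in Eb; exfalso; apply Ny; split; auto; right.
          repeat split; auto; apply CQ; auto; now apply (Ci0 x).
        - exfalso; apply Ny; split; auto; left; repeat split; auto; now apply (Cnb x y). }
      destruct (KI a Ha Aa Na) as [->|[Ka Ia]], (KI b Hb Ab Nb) as [->|[Kb Ib]];
        first [tauto | now apply adj_sym | now apply HK].
  - intros v; rewrite !in_app_iff; unfold l1, l2, l3; rewrite !In1, S1, S2, S3.
    split.
    + intros [(? & ? & ? & ?)|[(? & ? & ? & ?)|(? & ? & ? & ?)]]; auto.
    + intros (Hv & Hvi & Hc); destruct (inK v); [|tauto].
      right; rewrite <- adjb_spec; destruct (adjb E i0 v); [right|left]; repeat split; auto; discriminate.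
  - rewrite !weight_app; unfold l1, l2, l3; rewrite !weight_filter; unfold wsum; simpl.
    replace (wt n w i0 n) with 0%R
      by (unfold wt; rewrite Nat.eqb_refl, orb_true_r; reflexivity).
    replace (if C n then 0%R else 0%R) with 0%R by (destruct (C n); auto).
    assert (Hplus : forall m f g, rsum m (fun x => f x + g x)%R = (rsum m f + rsum m g)%R).
    { induction m; simpl; intros; [lra|]; rewrite IHm; lra. }
    rewrite <- !Hplus, Rplus_0_r; apply rsum_ext; intros x Hx.
    unfold P1, P2, P3, wt.
    destruct (Nat.eqb_spec x n); [lia|]; rewrite orb_false_r.
    destruct (Nat.eqb_spec x i0) as [->|].
    + rewrite (HiI Hx); destruct (C i0); simpl; lra.
    + destruct (C x), (inK x), (adjb E i0 x); simpl; lra.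
Qed.

(** The closed set is [s] together with [i0], where [i0] is an [I]-neighbour of a vertex of [s] that
    survives, or the dummy if there is none. *)
Lemma closed_of_shelling n inK E w s :
  is_split_graph n inK E -> shelling_from n E [] s ->
  exists i0 C, i0 <= n /\ (i0 < n -> inK i0 = false) /\ arc_closed n inK E i0 C /\
    weight w s = wsum (S n) (wt n w i0) C.
Proof.
  intros (HE & HK & HI) Hs.
  destruct (shelling_nodup n E s [] Hs) as [Hd Hn].
  assert (Hlt : forall x, In x s -> x < n) by (intros x Hx; now apply Hn).
  (* The last two premises are closure along the arcs leaving [i0] and along the arcs from the
     clique to [I]. *)
  assert (Hmain : forall i0, i0 <= n -> (i0 < n -> inK i0 = false) -> ~ In i0 s ->
    (forall k, i0 < n -> k < n -> inK k = true -> ~ adj E i0 k -> In k s) ->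
    (forall k i, i < n -> inK k = true -> inK i = false -> adj E k i -> In k s ->
       i <> i0 -> In i s) ->
    exists i0 C, i0 <= n /\ (i0 < n -> inK i0 = false) /\ arc_closed n inK E i0 C /\
      weight w s = wsum (S n) (wt n w i0) C).
  { intros i0 Hi0 HiI Hnin HQ HN.
    exists i0, (fun x => (x =? i0) || memb x s); split; [auto|split; [auto|split]].
    - intros u v Hu Hv; unfold arcb.
      destruct (Nat.eqb_spec v i0) as [->|Hvi]; [auto|].
      destruct (Nat.eqb_spec u i0) as [->|Hui]; simpl;
        rewrite !memb_spec, !andb_true_iff, !negb_true_iff, ?Nat.ltb_lt.
      + rewrite adjb_false; intros ((H1 & H2 & H3) & H4) _; now apply HQ.
      + rewrite adjb_spec; intros (((H1 & H2) & H3) & H4) Hus.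
        assert (Hvn : v < n) by (destruct H4 as [H4|H4]; apply HE in H4; tauto).
        apply andb_false_iff in H3; rewrite Nat.ltb_ge in H3.
        apply (HN u v); auto; destruct H3; [lia|auto].
    - unfold wsum; simpl.
      replace (wt n w i0 n) with 0%R
        by (unfold wt; rewrite Nat.eqb_refl, orb_true_r; reflexivity).
      rewrite <- (weight_memb w n s Hd Hlt).
      match goal with |- _ = (_ + ?t)%R => replace t with 0%R by (destruct orb; auto) end.
      rewrite Rplus_0_r; apply rsum_ext; intros x Hx; unfold wt.
      destruct (Nat.eqb_spec x n); [lia|]; rewrite orb_false_r.
      destruct (Nat.eqb_spec x i0) as [->|]; simpl; auto.
      destruct (memb i0 s) eqn:Em; auto; apply memb_spec in Em; tauto. }
  set (bad := fun k i => inK k && negb (inK i) && adjb E k i && negb (memb i s)).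
  destruct (existsb (fun k => existsb (bad k) (seq 0 n)) s) eqn:Eb.
  (* Any clique vertex [k] of [s] with a surviving [I]-neighbour [i] will do; it need not be the
     first one removed. *)
  - apply existsb_exists in Eb as (k & Hks & Eb); apply existsb_exists in Eb as (i & Hi & Eb).
    apply in_seq in Hi; unfold bad in Eb.
    rewrite !andb_true_iff, !negb_true_iff, adjb_spec in Eb.
    destruct Eb as (((Kk & Ii) & Aki) & Nis).
    assert (Nis' : ~ In i s) by (rewrite <- memb_spec; congruence).
    destruct (in_split k s Hks) as (s1 & s2 & Es).
    assert (Hsk : simplicial_in n E (rev s1) k) by (apply (shelling_split n E s1 k s2); congruence).
    assert (Hs1 : forall y, In y (rev s1) -> In y s).
    { intros y Hy; rewrite Es, in_app_iff; left; now apply in_rev. }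
    assert (Hall : forall k', k' < n -> inK k' = true -> ~ In k' s1 -> adj E i k').
    { intros k' Hk' Kk' Nk'.
      destruct (Nat.eq_dec k' k) as [->|]; [now apply adj_sym|].
      destruct Hsk as (_ & _ & Hsk); apply Hsk; auto; try lia.
      - rewrite <- in_rev; auto.
      - intros ->; congruence. }
    apply (Hmain i); auto; try lia.
    + intros k' _ Hk' Kk' Na.
      destruct (in_dec Nat.eq_dec k' s1) as [Hin|Hin]; [|exfalso; auto].
      rewrite Es, in_app_iff; auto.
    + intros k' i' Hi' Kk' Ii' Aki' Hks' Hne.
      destruct (in_dec Nat.eq_dec i' s) as [|Ni']; auto; exfalso.
      destruct (in_split k' s Hks') as (t1 & t2 & Et).
      assert (Hsk' : simplicial_in n E (rev t1) k')
        by (apply (shelling_split n E t1 k' t2); congruence).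
      assert (Ht1 : forall y, In y (rev t1) -> In y s).
      { intros y Hy; rewrite Et, in_app_iff; left; now apply in_rev. }
      destruct (adjb E i k') eqn:Ea.
      * apply adjb_spec, adj_sym in Ea.
        destruct Hsk' as (_ & _ & Hsk').
        apply (HI i i'); auto; try lia; apply Hsk'; auto; lia.
      * apply adjb_false in Ea.
        assert (Hin : In k' s1).
        { destruct (in_dec Nat.eq_dec k' s1); auto; exfalso; apply Ea, Hall; auto. }
        (* The prefix [s1] is split instead of [s], so that the part before [k'] is known to avoid
           [k]: then [k] is still present when [k'] is removed. *)
        clear t1 t2 Et Hsk' Ht1.
        destruct (in_split k' s1 Hin) as (t1 & t2 & Et).
        assert (Hsk' : simplicial_in n E (rev t1) k').
        { apply (shelling_split n E t1 k' (t2 ++ k :: s2)).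
          replace (t1 ++ k' :: t2 ++ k :: s2) with s; auto.
          now rewrite Es, Et, <- app_assoc. }
        assert (Ht1 : forall y, In y (rev t1) -> In y s1).
        { intros y Hy; rewrite Et, in_app_iff; left; now apply in_rev. }
        assert (Nk : ~ In k (rev t1)).
        { intros Hk; apply Ht1 in Hk; rewrite Es in Hd; apply NoDup_remove_2 in Hd.
          apply Hd, in_app_iff; auto. }
        assert (Akk : adj E k' k).
        { apply HK; auto; intros ->; apply Ea; now apply adj_sym. }
        assert (Hki' : adj E k i').
        { destruct Hsk' as (_ & _ & Hsk'); apply Hsk'; auto.
          - intros Hk; apply Ht1 in Hk; apply Ni'; rewrite Es, in_app_iff; auto.
          - intros ->; congruence. }
        destruct Hsk as (_ & _ & Hsk).
        apply (HI i i'); auto; try lia; apply Hsk; auto; lia.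
  - apply (Hmain n); auto; try lia.
    + intros Hin; apply Hlt in Hin; lia.
    + intros k i Hi Kk Ii Aki Hks _.
      destruct (memb i s) eqn:Em; [now apply memb_spec|exfalso].
      assert (Et : existsb (fun k => existsb (bad k) (seq 0 n)) s = true); [|congruence].
      apply existsb_exists; exists k; split; auto; apply existsb_exists; exists i.
      split; [apply in_seq; lia|]; unfold bad; apply adjb_spec in Aki.
      now rewrite Kk, Ii, Aki, Em.
Qed.

(** * The program and its correctness *)

Local Arguments upd {A} f !a x !y /.
Local Notation "c1 ;; c2" := (Seq c1 c2) (at level 61, right associativity).

(** With the dummy there are [M = n + 1] nodes. Then [n + 3] is [M + 2], the cube root of the number
    of rounds, and [n + 2] is both the top label [M + 1] and the offset of the edge list on the
    tape. *)
Definition params (n m q : nat) : nat := nth q [n; m; n + 1; n + 3; 1; 0; n + 2; 0] 0.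

Definition par (n m : nat) (s : state) : Prop := forall q, q < 8 -> ns s q = params n m q.

(** With truncated subtraction, [(a - b) + (b - a)] vanishes exactly when [a = b]. *)
Definition eqtest (d t a b : nat) : cmd :=
  Do (OSub d a b);; Do (OSub t b a);; Do (OAdd d d t).

(* Node registers: 8 holds i0, 9 and 10 the endpoints u and v.
   Nat arrays: 0 row offsets, 1 clique membership, 2 adjacency, 3 arcs, 4 labels.
   Real arrays: 0 weights, 1 excesses, 2 flow; real register 0 is the best weight. *)
Definition cmd_push : cmd :=
  Do (OLd 13 4 9);; Do (OLd 14 4 10);; Do (OAdd 17 14 4);; eqtest 15 16 13 17;;
  IfZ 15
    (Do (OSub 15 2 14);;
     IfZ 15 Skip
       (Do (ORLd 2 1 9);; Do (ORZero 4);;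
        IfR 2 4 Skip
          (Do (OLd 11 0 9);; Do (OAdd 11 11 10);; Do (OLd 15 3 11);;
           IfZ 15
             (Do (OLd 12 0 10);; Do (OAdd 12 12 9);; Do (ORLd 3 2 12);;
              IfR 3 2 (Do (ORAdd 5 3 4)) (Do (ORAdd 5 2 4));;
              Do (ORSub 3 3 5);; Do (ORSt 2 12 3))
             (Do (ORAdd 5 2 4);; Do (ORLd 3 2 11);; Do (ORAdd 3 3 5);; Do (ORSt 2 11 3));;
           Do (ORSub 2 2 5);; Do (ORSt 1 9 2);;
           Do (ORLd 6 1 10);; Do (ORAdd 6 6 5);; Do (ORSt 1 10 6))))
    Skip.

Definition cmd_scan : cmd := For 10 2 cmd_push.

Definition cmd_relabel : cmd :=
  Do (ORLd 2 1 9);; Do (ORZero 4);;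
  IfR 2 4 Skip
    (Do (OLd 13 4 9);; Do (OAdd 15 2 4);; Do (OSub 15 15 13);;
     IfZ 15 Skip (Do (OAdd 13 13 4);; Do (OSt 4 9 13))).

Definition cmd_pass : cmd := For 9 2 (cmd_scan;; cmd_relabel).

(** Loop bounds are read-only registers, so the cube of [n + 3] arises from nesting three loops. *)
Definition cmd_passes : cmd := For 24 3 (For 25 3 (For 26 3 cmd_pass)).

(** No test for [i0 < n] is made: the adjacency row of the dummy is filled with ones, so that no arc
    to another node leaves it when [i0 = n]. The flow on the arc is reset on the way. *)
Definition cmd_arc : cmd :=
  Do (OLd 11 0 9);; Do (OAdd 11 11 10);; Do (ORZero 3);; Do (ORSt 2 11 3);;
  Do (OLd 13 1 9);; Do (OLd 14 1 10);; eqtest 15 16 10 8;;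
  IfZ 15 (Do (OConst 15 1))
    (eqtest 15 16 9 8;;
     IfZ 15
       (Do (OLd 12 2 11);; IfZ 12 (Do (OAdd 15 14 5)) (Do (OConst 15 0)))
       (IfZ 13 (Do (OConst 15 0)) (IfZ 14 (Do (OLd 15 2 11)) (Do (OConst 15 0)))));;
  Do (OSt 3 11 15).

Definition cmd_arcs : cmd := For 9 2 (For 10 2 cmd_arc).

Definition cmd_nodes : cmd :=
  For 10 2
    (Do (OSt 4 10 5);; eqtest 15 16 10 8;;
     IfZ 15 (Do (ORZero 2))
       (eqtest 15 16 10 0;; IfZ 15 (Do (ORZero 2)) (Do (ORIn 2 10)));;
     Do (ORSt 0 10 2);; Do (ORSt 1 10 2)).

Definition cmd_level : cmd :=
  For 10 2
    (Do (OLd 14 4 10);; eqtest 15 13 14 16;; IfZ 15 (Do (OConst 21 0)) Skip).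

(** Register 22 starts at [M + 1], and each empty level found among 1, ..., [M] overwrites it. *)
Definition cmd_gap : cmd :=
  Do (OAdd 22 6 5);;
  For 20 2
    (Do (OAdd 16 20 4);; Do (OConst 21 1);; cmd_level;;
     IfZ 21 Skip (Do (OAdd 22 16 5))).

Definition cmd_sum : cmd :=
  Do (ORZero 1);;
  For 10 2
    (Do (OLd 14 4 10);; Do (OSub 15 22 14);;
     IfZ 15 (Do (ORLd 2 0 10);; Do (ORAdd 1 1 2)) Skip).

Definition cmd_write : cmd :=
  For 10 0
    (Do (OLd 14 4 10);; Do (OSub 15 22 14);; Do (OConst 13 0);;
     IfZ 15 (eqtest 15 16 10 8;; IfZ 15 Skip (Do (OConst 13 1))) Skip;;
     Do (OOut 10 13)).

Definition cmd_record : cmd :=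
  IfR 1 0 Skip (Do (ORZero 2);; Do (ORAdd 0 1 2);; cmd_write).

Definition cmd_solve : cmd :=
  cmd_arcs;; cmd_nodes;; cmd_passes;; cmd_gap;; cmd_sum;; cmd_record.

Definition cmd_rows : cmd :=
  Do (OConst 15 0);; For 9 2 (Do (OSt 0 9 15);; Do (OAdd 15 15 2)).

Definition cmd_clique : cmd :=
  For 10 0 (Do (OAdd 15 10 4);; Do (OAdd 15 15 4);; Do (OIn 15 15);; Do (OSt 1 10 15)).

Definition cmd_edges : cmd :=
  For 23 1
    (Do (OAdd 15 23 23);; Do (OAdd 15 15 6);; Do (OIn 9 15);;
     Do (OAdd 15 15 4);; Do (OIn 10 15);;
     Do (OLd 11 0 9);; Do (OAdd 11 11 10);; Do (OSt 2 11 4);;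
     Do (OLd 11 0 10);; Do (OAdd 11 11 9);; Do (OSt 2 11 4)).

Definition cmd_last_row : cmd :=
  Do (OLd 11 0 0);; For 10 2 (Do (OAdd 12 11 10);; Do (OSt 2 12 4)).

Definition cmd_setup : cmd := cmd_rows;; cmd_clique;; cmd_edges;; cmd_last_row.

(** The clique flag of the dummy is never written and stays 0, so the same test that skips clique
    vertices admits the case without exception. *)
Definition cmd_main : cmd :=
  cmd_setup;; For 8 2 (Do (OLd 15 1 8);; IfZ 15 cmd_solve Skip).

(** * Loop rule and symbolic execution *)

Lemma par_setn n m i x s : 8 <= i -> par n m s -> par n m (setn i x s).
Proof. intros Hi H q Hq; simpl; rewrite upd_neq by lia; auto. Qed.

Lemma par_run n m inp W c s : wf c = true -> par n m s -> par n m (run inp W c s).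
Proof. intros Hw H q Hq; rewrite nowr_run; auto using wf_nowr. Qed.

(** The rule itself tracks the value of the counter, so invariants need not mention it; they must
    only survive its update. *)
Lemma for_rule inp W (J : nat -> state -> Prop) i q c s :
  J 0 (setn i 0 s) ->
  (forall k t, k < ns s q -> ns t i = k -> J k t -> J (S k) (setn i (S k) (run inp W c t))) ->
  J (ns s q) (run inp W (For i q c) s).
Proof.
  intros H0 HS; simpl; assert (HL : forall k, k <= ns s q ->
    J k (loop (run inp W c) i k s) /\ ns (loop (run inp W c) i k s) i = k); [|now apply HL].
  induction k; intros Hk; [simpl; split; auto; apply upd_eq|].
  destruct IHk as [HJ Hi]; [lia|]; split; [|simpl; apply upd_eq].
  now apply HS.
Qed.

Definition rows (n : nat) (s : state) : Prop := forall x, x < n + 1 -> na s 0 x = x * (n + 1).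

Definition abs (s : state) : pst := mkP (ra s 2) (ra s 1) (na s 4).

Lemma run_seq inp W c1 c2 s : run inp W (c1;; c2) s = run inp W c2 (run inp W c1 s).
Proof. reflexivity. Qed.

Ltac ev t :=
  let t' := eval cbv beta iota delta [runop setn setr setna setra seto ns na rs ra so] in t in
  eval cbn [upd Nat.eqb] in t'.

(** One instruction is executed by conversion on a state given by its five components. [ev] resolves
    only comparisons of literal register numbers, so updates at symbolic indices stay folded. *)
Ltac sx1 :=
  match goal with
  | |- context [run ?i ?w (Do ?o) (mkState ?a ?b ?c ?d ?e)] =>
      let s := constr:(mkState a b c d e) in
      let t := ev (runop i w o s) in
      change (run i w (Do o) s) with t
  | |- context [run ?i ?w Skip ?s] => change (run i w Skip s) with s
  | |- context [run ?i ?w (IfZ ?x ?c1 ?c2) (mkState ?a ?b ?c ?d ?e)] =>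
      let s := constr:(mkState a b c d e) in
      let t := ev (ns s x) in
      change (run i w (IfZ x c1 c2) s) with
        (if Nat.eqb t 0 then run i w c1 s else run i w c2 s)
  | |- context [run ?i ?w (IfR ?x ?y ?c1 ?c2) (mkState ?a ?b ?c ?d ?e)] =>
      let s := constr:(mkState a b c d e) in
      let t := ev (rs s x) in
      let t' := ev (rs s y) in
      change (run i w (IfR x y c1 c2) s) with
        (if Rle_dec t t' then run i w c1 s else run i w c2 s)
  end.

Ltac sx := rewrite ?run_seq; repeat (sx1; rewrite ?run_seq).

Ltac params_of H :=
  pose proof (H 0 ltac:(lia)) as HP0; pose proof (H 1 ltac:(lia)) as HP1;
  pose proof (H 2 ltac:(lia)) as HP2; pose proof (H 3 ltac:(lia)) as HP3;
  pose proof (H 4 ltac:(lia)) as HP4; pose proof (H 5 ltac:(lia)) as HP5;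
  pose proof (H 6 ltac:(lia)) as HP6;
  unfold params in HP0, HP1, HP2, HP3, HP4, HP5, HP6;
  cbn [nth ns] in HP0, HP1, HP2, HP3, HP4, HP5, HP6.

(** * The code performs push-relabel rounds *)

Lemma push_run n m inp W s u v : par n m s -> rows n s ->
  ns s 9 = u -> ns s 10 = v -> u < n + 1 -> v < n + 1 ->
  abs (run inp W cmd_push s) = push (n + 1) (na s 3) u v (abs s).
Proof.
  intros HP HR E9 E10 Hu Hv; subst u v; destruct s as [N NA RR RA O]; params_of HP.
  unfold cmd_push, eqtest, push, abs, rows in *; cbn [ns na rs ra so pE pF pD] in *.
  pose proof (HR _ Hu) as Ru; pose proof (HR _ Hv) as Rv.
  sx; rewrite !HP4, !HP2.
  destruct (Nat.eqb_spec (NA 4 (N 9)) (NA 4 (N 10) + 1)) as [Ed|Ed];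
    match goal with |- context [Nat.eqb ?t 0] => destruct (Nat.eqb_spec t 0) as [E|E] end;
    try lia; cbn [andb]; [|reflexivity].
  destruct (Nat.ltb_spec (NA 4 (N 10)) (n + 1)) as [L|L];
    match goal with |- context [Nat.eqb ?t 0] => destruct (Nat.eqb_spec t 0) as [E'|E'] end;
    try lia; [|reflexivity].
  destruct (Rle_dec (RA 1 (N 9)) 0) as [P|P]; [reflexivity|].
  rewrite !Ru, !Rv.
  destruct (Nat.eqb_spec (NA 3 (N 9 * (n + 1) + N 10)) 0) as [Z|Z]; sx.
  (* The machine has no copy between real registers; the code adds a zero register, which is removed
     here. *)
  - destruct Rle_dec as [Q|Q]; sx; unfold move; rewrite !Rplus_0_r; reflexivity.
  - unfold move; rewrite !Rplus_0_r; reflexivity.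
Qed.

Definition ctx (n m : nat) (A : nat -> nat) (s : state) : Prop :=
  par n m s /\ rows n s /\ na s 3 = A.

Lemma ctx_setn n m A i x s : 8 <= i -> ctx n m A s -> ctx n m A (setn i x s).
Proof. intros Hi (H1 & H2 & H3); split; [now apply par_setn|now split]. Qed.

Lemma ctx_run n m A inp W c s :
  wf c && allops (nowrnaop 0) c && allops (nowrnaop 3) c = true ->
  ctx n m A s -> ctx n m A (run inp W c s).
Proof.
  rewrite !andb_true_iff; intros [[W1 W2] W3] (H1 & H2 & H3); split; [now apply par_run|].
  unfold rows; rewrite !nowrna_run; auto.
Qed.

Lemma abs_setn i x s : abs (setn i x s) = abs s.
Proof. reflexivity. Qed.

Lemma ns_setn i x s y : y <> i -> ns (setn i x s) y = ns s y.
Proof. apply upd_neq. Qed.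

Lemma scan_run n m A inp W s u : ctx n m A s -> ns s 9 = u -> u < n + 1 ->
  abs (run inp W cmd_scan s) = scan (n + 1) A u (abs s).
Proof.
  intros HC E9 Hu; unfold cmd_scan, scan.
  set (J := fun k t => ctx n m A t /\ ns t 9 = u /\
    abs t = iterk (push (n + 1) A u) k (abs s)).
  assert (HJ : J (ns s 2) (run inp W (For 10 2 cmd_push) s)).
  { pose proof (proj1 HC 2 ltac:(lia)) as E2; change (params n m 2) with (n + 1) in E2.
    apply for_rule.
    - split; [apply ctx_setn; auto; lia|split; auto].
    - rewrite E2; intros k t Hk Et (HCt & Et9 & Ea).
      split; [apply ctx_setn; [lia|]; now apply ctx_run|split].
      + rewrite ns_setn by lia; now rewrite nowr_run.
      + rewrite abs_setn; cbn [iterk].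
        destruct HCt as (HPt & HRt & <-).
        rewrite (push_run n m inp W t u k), Ea; auto. }
  destruct HJ as (_ & _ & ->); now rewrite (proj1 HC 2) by lia.
Qed.

Lemma relabel_run n m inp W s u : par n m s -> ns s 9 = u ->
  abs (run inp W cmd_relabel s) = relabel (n + 1) u (abs s).
Proof.
  intros HP E9; subst u; destruct s as [N NA RR RA O]; params_of HP.
  unfold cmd_relabel, relabel, abs; cbn [ns na rs ra so pE pF pD] in *.
  sx; rewrite !HP4, !HP2.
  destruct Rle_dec as [P|P]; [reflexivity|].
  destruct (Nat.leb_spec (NA 4 (N 9)) (n + 1)) as [L|L];
    match goal with |- context [Nat.eqb ?t 0] => destruct (Nat.eqb_spec t 0) as [E'|E'] end;
    try lia; reflexivity.
Qed.

Lemma pass_run n m A inp W s : ctx n m A s ->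
  abs (run inp W cmd_pass s) = pass (n + 1) A (abs s).
Proof.
  intros HC; unfold cmd_pass, pass; set (body := cmd_scan;; cmd_relabel).
  set (J := fun k t => ctx n m A t /\ abs t = iterk (disch (n + 1) A) k (abs s)).
  assert (HJ : J (ns s 2) (run inp W (For 9 2 body) s)).
  { pose proof (proj1 HC 2 ltac:(lia)) as E2; change (params n m 2) with (n + 1) in E2.
    apply for_rule.
    - split; [apply ctx_setn; auto; lia|auto].
    - rewrite E2; intros k t Hk Et (HCt & Ea).
      split; [apply ctx_setn; [lia|]; now apply ctx_run|].
      rewrite abs_setn; cbn [iterk]; unfold body; rewrite run_seq.
      unfold disch at 1; rewrite <- Ea, <- (scan_run n m A inp W t k); auto.
      apply (relabel_run n m).
      + apply par_run; auto; apply HCt.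
      + now rewrite nowr_run. }
  destruct HJ as (_ & ->); now rewrite (proj1 HC 2) by lia.
Qed.

Lemma iterk_const_mul {T : Type} (f : T -> T) j k x :
  iterk (fun _ => iterk (fun _ => f) j) k x = iterk (fun _ => f) (k * j) x.
Proof.
  assert (Hadd : forall a b y, iterk (fun _ => f) (a + b) y =
    iterk (fun _ => f) a (iterk (fun _ => f) b y)).
  { induction a; simpl; intros; auto; now rewrite IHa. }
  induction k; simpl; auto; now rewrite IHk, Hadd.
Qed.

Lemma repeat_run n m A inp W c f i :
  8 <= i -> wf c && allops (nowrnaop 0) c && allops (nowrnaop 3) c = true ->
  (forall s, ctx n m A s -> abs (run inp W c s) = f (abs s)) ->
  forall s, ctx n m A s ->
  abs (run inp W (For i 3 c) s) = iterk (fun _ => f) (n + 3) (abs s).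
Proof.
  intros Hi Hw Hf s HC.
  set (J := fun k t => ctx n m A t /\ abs t = iterk (fun _ => f) k (abs s)).
  assert (HJ : J (ns s 3) (run inp W (For i 3 c) s)).
  { apply for_rule.
    - split; [apply ctx_setn; auto; lia|auto].
    - intros k t Hk Et (HCt & Ea).
      split; [apply ctx_setn; [lia|]; now apply ctx_run|].
      rewrite abs_setn; cbn [iterk]; now rewrite Hf, Ea. }
  destruct HJ as (_ & ->); now rewrite (proj1 HC 3) by lia.
Qed.

Lemma passes_run n m A inp W s : ctx n m A s ->
  abs (run inp W cmd_passes s) =
  iterk (fun _ => pass (n + 1) A) ((n + 3) * ((n + 3) * (n + 3))) (abs s).
Proof.
  intros HC; unfold cmd_passes.
  rewrite <- iterk_const_mul.
  apply (repeat_run n m A); auto; [lia|]; intros t1 H1.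
  rewrite <- iterk_const_mul.
  apply (repeat_run n m A); auto; [lia|]; intros t2 H2.
  apply (repeat_run n m A); auto; [lia|]; intros t3 H3.
  now apply (pass_run n m A).
Qed.

(** * Building the network for one exception *)

Definition data (n : nat) (inK : nat -> bool) (E : list (nat * nat)) (s : state) : Prop :=
  rows n s /\
  (forall x, x < n + 1 -> (na s 1 x =? 0) = negb ((x <? n) && inK x)) /\
  (forall u v, u < n -> v < n + 1 -> (na s 2 (u * (n + 1) + v) =? 0) = negb (adjb E u v)) /\
  (forall v, v < n + 1 -> na s 2 (n * (n + 1) + v) <> 0).

Definition base (n m : nat) (inK : nat -> bool) (E : list (nat * nat)) (i0 : nat)
    (s : state) : Prop :=
  par n m s /\ data n inK E s /\ ns s 8 = i0.

Lemma base_setn n m inK E i0 i x s : 9 <= i -> base n m inK E i0 s -> base n m inK E i0 (setn i x s).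
Proof.
  intros Hi (H1 & H2 & H3); split; [apply par_setn; auto; lia|split; auto].
  rewrite ns_setn; auto; lia.
Qed.

Lemma base_run n m inK E i0 inp W c s :
  wf c && nowr 8 c && allops (nowrnaop 0) c && allops (nowrnaop 1) c &&
    allops (nowrnaop 2) c = true ->
  base n m inK E i0 s -> base n m inK E i0 (run inp W c s).
Proof.
  rewrite !andb_true_iff; intros ((((W1 & W2) & W3) & W4) & W5) (H1 & H2 & H3).
  split; [now apply par_run|split].
  - unfold data, rows in *; rewrite !nowrna_run; auto.
  - rewrite nowr_run; auto.
Qed.

Ltac iftest :=
  match goal with |- context [if Nat.eqb ?t 0 then _ else _] =>
    destruct (Nat.eqb_spec t 0) end.

Lemma arc_run n m inK E i0 inp W s u v :
  base n m inK E i0 s -> i0 <= n -> ns s 9 = u -> ns s 10 = v -> u < n + 1 -> v < n + 1 ->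
  exists x, na (run inp W cmd_arc s) 3 = upd (na s 3) (u * (n + 1) + v) x /\
    (x =? 0) = negb (arcb n inK E i0 u v) /\
    ra (run inp W cmd_arc s) 2 = upd (ra s 2) (u * (n + 1) + v) 0%R.
Proof.
  intros (HP & (HR & HK & HA & HN) & E8) Hi E9 E10 Hu Hv; subst i0 u v.
  destruct s as [N NA RR RA O]; params_of HP.
  unfold cmd_arc, eqtest, rows in *; cbn [ns na rs ra so] in *.
  pose proof (HR _ Hu) as Ru.
  pose proof (HK _ Hu) as Ku; pose proof (HK _ Hv) as Kv.
  set (p := N 9 * (n + 1) + N 10) in *.
  unfold arcb.
  sx; rewrite !Ru; fold p.
  destruct (Nat.eqb_spec (N 10) (N 8)); iftest; try lia; sx; cbn [na ra upd Nat.eqb].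
  { exists 1; auto. }
  destruct (Nat.eqb_spec (N 9) (N 8)) as [Eu|Eu]; iftest; try lia; sx; rewrite ?Ru; fold p.
  - rewrite <- Eu.
    destruct (Nat.ltb_spec (N 9) n) as [L|L].
    + pose proof (HA _ _ L Hv) as HAp; fold p in HAp; rewrite HAp.
      destruct (adjb E (N 9) (N 10)); cbn [negb]; sx; cbn [na ra upd Nat.eqb].
      * exists 0; rewrite andb_false_r; auto.
      * exists (NA 1 (N 10) + N 5); rewrite HP5, Nat.add_0_r, Kv, andb_true_r; auto.
    (* Here [u = i0 = n], and the filled last row does the work of the missing test [i0 < n]. *)
    + pose proof (HN _ Hv) as HAp.
      assert (Ep : n * (n + 1) + N 10 = p) by (unfold p; do 2 f_equal; lia).
      rewrite Ep in HAp.
      iftest; [tauto|]; sx; cbn [na ra upd Nat.eqb]; exists 0; auto.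
  - rewrite Ku; destruct ((N 9 <? n) && inK (N 9)) eqn:EK; cbn [negb andb]; sx;
      cbn [na ra upd Nat.eqb]; [|exists 0; auto].
    rewrite Kv; destruct ((N 10 <? n) && inK (N 10)); cbn [negb andb]; sx;
      cbn [na ra upd Nat.eqb]; [exists 0; auto|].
    exists (NA 2 p); split; auto; split; auto.
    apply andb_true_iff in EK as [L _]; apply Nat.ltb_lt in L; now apply HA.
Qed.

Definition cell_ok (n : nat) (inK : nat -> bool) (E : list (nat * nat)) (i0 : nat)
    (s : state) (x y : nat) : Prop :=
  (na s 3 (x * (n + 1) + y) =? 0) = negb (arcb n inK E i0 x y) /\
  ra s 2 (x * (n + 1) + y) = 0%R.

Lemma cell_ok_setn n inK E i0 i k s x y :
  cell_ok n inK E i0 (setn i k s) x y = cell_ok n inK E i0 s x y.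
Proof. reflexivity. Qed.

Lemma arcs_run n m inK E i0 inp W s : base n m inK E i0 s -> i0 <= n ->
  forall x y, x < n + 1 -> y < n + 1 -> cell_ok n inK E i0 (run inp W cmd_arcs s) x y.
Proof.
  intros HB Hi; unfold cmd_arcs; set (inner := For 10 2 cmd_arc).
  set (J := fun k t => base n m inK E i0 t /\
    forall x y, y < n + 1 -> x < k -> cell_ok n inK E i0 t x y).
  assert (HJ : J (ns s 2) (run inp W (For 9 2 inner) s)).
  { apply for_rule.
    - split; [apply base_setn; auto|intros; lia].
    - rewrite (proj1 HB 2) by lia; change (params n m 2) with (n + 1).
      intros k t Hk Et (HBt & Hc).
      set (J' := fun j t' => base n m inK E i0 t' /\ ns t' 9 = k /\
        forall x y, y < n + 1 -> x < k \/ (x = k /\ y < j) -> cell_ok n inK E i0 t' x y).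
      assert (HJ' : J' (ns t 2) (run inp W inner t)).
      { apply for_rule.
        - split; [apply base_setn; auto; lia|split; [rewrite ns_setn; auto; lia|]].
          intros x y Hy [Hx|Hx]; [|lia]; rewrite cell_ok_setn; now apply Hc.
        - rewrite (proj1 HBt 2) by lia; change (params n m 2) with (n + 1).
          intros j t' Hj Et' (HBt' & Et9 & Hc').
          split; [apply base_setn; [lia|]; now apply base_run|].
          split; [rewrite ns_setn by lia; now rewrite nowr_run|].
          intros x y Hy Hxy.
          destruct (arc_run n m inK E i0 inp W t' k j) as (z & E3 & Ez & E2); auto.
          rewrite cell_ok_setn; unfold cell_ok; rewrite E3, E2, !upd_idx; auto.
          destruct (Nat.eqb_spec x k) as [->|]; [destruct (Nat.eqb_spec y j) as [->|]|];
            cbn [andb]; auto; apply Hc'; auto; lia. }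
      rewrite (proj1 HBt 2) in HJ' by lia; change (params n m 2) with (n + 1) in HJ'.
      destruct HJ' as (HB' & _ & Hc'); split; [apply base_setn; auto|].
      intros x y Hy Hx; rewrite cell_ok_setn; apply Hc'; auto; lia. }
  rewrite (proj1 HB 2) in HJ by lia; change (params n m 2) with (n + 1) in HJ.
  destruct HJ as [_ HJ]; auto.
Qed.

Lemma nodes_run n m inK E i0 inp W s : base n m inK E i0 s ->
  forall x, x < n + 1 -> let t := run inp W cmd_nodes s in
    na t 4 x = 0 /\ ra t 0 x = wt n W i0 x /\ ra t 1 x = wt n W i0 x.
Proof.
  intros HB; unfold cmd_nodes; set (body := Seq (Do (OSt 4 10 5)) _).
  set (J := fun k t => base n m inK E i0 t /\ forall x, x < k ->
    na t 4 x = 0 /\ ra t 0 x = wt n W i0 x /\ ra t 1 x = wt n W i0 x).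
  assert (HJ : J (ns s 2) (run inp W (For 10 2 body) s)).
  { apply for_rule.
    - split; [apply base_setn; auto; lia|intros; lia].
    - intros k t Hk Et (HBt & Hx).
      split; [apply base_setn; [lia|]; now apply base_run|].
      assert (Hbody : na (run inp W body t) 4 = upd (na t 4) k 0 /\
        ra (run inp W body t) 0 = upd (ra t 0) k (wt n W i0 k) /\
        ra (run inp W body t) 1 = upd (ra t 1) k (wt n W i0 k)).
      { destruct HBt as (HP & _ & E8); subst i0 k; clear Hx Hk.
        destruct t as [N NA RR RA O]; params_of HP.
        unfold body, eqtest, wt; cbn [ns na rs ra so] in *; sx.
        destruct (Nat.eqb_spec (N 10) (N 8)); iftest; try lia; sx; cbn [na ra upd Nat.eqb orb];
          rewrite HP5; auto.
        destruct (Nat.eqb_spec (N 10) n); iftest; try lia; sx; cbn [na ra upd Nat.eqb];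
          auto. }
      destruct Hbody as (E1 & E2 & E3).
      intros x Hxk; cbn [na ra setn]; rewrite E1, E2, E3; unfold upd.
      destruct (Nat.eqb_spec x k) as [->|]; auto; apply Hx; lia. }
  rewrite (proj1 HB 2) in HJ by lia; apply HJ.
Qed.

(** * Extracting and recording a solution *)

Lemma level_run n m inp W s g : par n m s -> ns s 16 = g -> ns s 21 = 1 ->
  (ns (run inp W cmd_level s) 21 = 0 /\ exists x, x < n + 1 /\ na s 4 x = g) \/
  (ns (run inp W cmd_level s) 21 = 1 /\ forall x, x < n + 1 -> na s 4 x <> g).
Proof.
  intros HP E16 E21; unfold cmd_level; set (body := Seq (Do (OLd 14 4 10)) _).
  set (J := fun k t => par n m t /\ ns t 16 = g /\ na t 4 = na s 4 /\
    ((ns t 21 = 0 /\ exists x, x < k /\ na s 4 x = g) \/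
     (ns t 21 = 1 /\ forall x, x < k -> na s 4 x <> g))).
  assert (HJ : J (ns s 2) (run inp W (For 10 2 body) s)).
  { apply for_rule.
    - split; [apply par_setn; auto; lia|]; rewrite !ns_setn by lia; repeat split; auto.
      right; split; auto; intros; lia.
    - intros k t Hk Et (HPt & Et16 & Ena & Hd).
      split; [apply par_setn; [lia|]; now apply par_run|].
      rewrite !ns_setn by lia; cbn [na setn].
      rewrite nowr_run, nowrna_run by reflexivity; split; auto; split; auto.
      assert (Hbody : ns (run inp W body t) 21 = if na s 4 k =? g then 0 else ns t 21).
      { rewrite <- Ena; clear Hd; subst k g; destruct t as [N NA RR RA O].
        unfold body, eqtest; cbn [ns na rs ra so] in *; rewrite <- Et16; sx.
        destruct (Nat.eqb_spec (NA 4 (N 10)) (N 16)); iftest; try lia; reflexivity. }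
      rewrite Hbody; destruct (Nat.eqb_spec (na s 4 k) g) as [Eg|Eg].
      + left; split; auto; exists k; split; auto.
      + destruct Hd as [[Hd (x & Hx & Ex)]|[Hd Hx]]; [left|right]; split; auto.
        * exists x; split; auto; lia.
        * intros x Hxk; destruct (Nat.eq_dec x k) as [->|]; auto; apply Hx; lia. }
  rewrite (HP 2) in HJ by lia; change (params n m 2) with (n + 1) in HJ.
  apply HJ.
Qed.

Lemma gap_run n m inp W s : par n m s ->
  let g := ns (run inp W cmd_gap s) 22 in
  1 <= g <= n + 1 + 1 /\ forall x, x < n + 1 -> na s 4 x <> g.
Proof.
  intros HP; unfold cmd_gap; rewrite run_seq; set (s1 := run inp W (Do _) s).
  assert (HP1 : par n m s1) by (now apply par_run).
  assert (E22 : ns s1 22 = n + 1 + 1).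
  { pose proof (HP 6 ltac:(lia)) as H6; pose proof (HP 5 ltac:(lia)) as H5.
    unfold params in H5, H6; cbn [nth] in H5, H6.
    change (ns s1 22) with (ns s 6 + ns s 5); lia. }
  change (na s 4) with (na s1 4).
  set (body := Seq (Do (OAdd 16 20 4)) _).
  set (J := fun k t => par n m t /\ na t 4 = na s1 4 /\
    ((1 <= ns t 22 <= n + 1 /\ forall x, x < n + 1 -> na s1 4 x <> ns t 22) \/
     (ns t 22 = n + 1 + 1 /\ forall g, 1 <= g <= k -> exists x, x < n + 1 /\ na s1 4 x = g))).
  assert (HJ : J (ns s1 2) (run inp W (For 20 2 body) s1)).
  { apply for_rule.
    - split; [apply par_setn; auto; lia|]; rewrite !ns_setn by lia; split; auto.
      right; split; auto; intros; lia.
    - rewrite (HP1 2) by lia; change (params n m 2) with (n + 1).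
      intros k t Hk Et (HPt & Ena & Hd).
      split; [apply par_setn; [lia|]; now apply par_run|].
      rewrite !ns_setn by lia; cbn [na setn].
      rewrite nowrna_run by reflexivity; split; auto.
      unfold body; rewrite !run_seq.
      set (t1 := run inp W (Do (OAdd 16 20 4)) t); set (t2 := run inp W (Do (OConst 21 1)) t1).
      assert (HPt2 : par n m t2) by (now apply par_run, par_run).
      assert (E16 : ns t2 16 = k + 1).
      { change (ns t2 16) with (ns t 20 + ns t 4); rewrite Et, (HPt 4) by lia; reflexivity. }
      assert (Et22 : ns t2 22 = ns t 22) by reflexivity.
      assert (En4 : na t2 4 = na s1 4) by (exact Ena).
      assert (L := level_run n m inp W t2 (k + 1) HPt2 E16 eq_refl).
      rewrite En4 in L; set (t3 := run inp W cmd_level t2) in *.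
      assert (E16' : ns t3 16 = k + 1) by (unfold t3; now rewrite nowr_run).
      assert (E22' : ns t3 22 = ns t 22) by (unfold t3; now rewrite nowr_run).
      assert (E5' : ns t3 5 = 0) by (unfold t3; rewrite nowr_run; auto; rewrite (HPt2 5) by lia; auto).
      clearbody t3; destruct t3 as [N NA RR RA O]; cbn [ns] in *; sx.
      destruct L as [[-> He]|[-> He]]; cbn [Nat.eqb ns upd].
      + rewrite E22'; destruct Hd as [Hd|[Hd1 Hd2]]; [now left|right; split; auto].
        intros g Hg; destruct (Nat.eq_dec g (k + 1)) as [->|]; auto; apply Hd2; lia.
      + left; rewrite E16', E5', Nat.add_0_r; split; auto; lia. }
  rewrite (HP1 2) in HJ by lia; change (params n m 2) with (n + 1) in HJ.
  destruct HJ as (_ & _ & [[H1 H2]|[-> H2]]); split; auto; try lia.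
  now apply top_level_empty.
Qed.

Lemma sum_run n m inp W s : par n m s ->
  rs (run inp W cmd_sum s) 1 = wsum (n + 1) (ra s 0) (fun x => ns s 22 <=? na s 4 x).
Proof.
  intros HP; unfold cmd_sum; rewrite run_seq; set (s1 := run inp W (Do _) s).
  assert (HP1 : par n m s1) by (now apply par_run).
  change (ra s 0) with (ra s1 0); change (ns s 22) with (ns s1 22);
    change (na s 4) with (na s1 4).
  set (body := Seq (Do (OLd 14 4 10)) _).
  set (J := fun k t => ns t 22 = ns s1 22 /\ na t 4 = na s1 4 /\ ra t 0 = ra s1 0 /\
    rs t 1 = wsum k (ra s1 0) (fun x => ns s1 22 <=? na s1 4 x)).
  assert (HJ : J (ns s1 2) (run inp W (For 10 2 body) s1)).
  { apply for_rule.
    - repeat split; auto; apply ns_setn; lia.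
    - intros k t Hk Et (E22 & Ena & Era & Ers).
      unfold J; rewrite ns_setn by lia; cbn [na ra rs setn].
      rewrite nowr_run, nowrna_run, nowrra_run by reflexivity; repeat split; auto.
      unfold wsum in *; cbn [rsum]; rewrite <- Ers, <- E22, <- Ena, <- Era.
      clear Ers E22 Ena Era Hk; subst k; destruct t as [N NA RR RA O].
      unfold body; cbn [ns na rs ra so] in *; sx.
      destruct (Nat.leb_spec (N 22) (NA 4 (N 10))); iftest; try lia;
        cbn [rs upd Nat.eqb]; ring. }
  rewrite (HP1 2) in HJ by lia; change (params n m 2) with (n + 1) in HJ.
  apply HJ.
Qed.

Lemma write_run n m inp W s : par n m s -> forall x, x < n ->
  so (run inp W cmd_write s) x =
  if (ns s 22 <=? na s 4 x) && negb (x =? ns s 8) then 1 else 0.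
Proof.
  intros HP; unfold cmd_write; set (body := Seq (Do (OLd 14 4 10)) _).
  set (J := fun k t => ns t 22 = ns s 22 /\ ns t 8 = ns s 8 /\ na t 4 = na s 4 /\
    forall x, x < k ->
      so t x = if (ns s 22 <=? na s 4 x) && negb (x =? ns s 8) then 1 else 0).
  assert (HJ : J (ns s 0) (run inp W (For 10 0 body) s)).
  { apply for_rule.
    - repeat split; auto; try (apply ns_setn; lia); intros; lia.
    - intros k t Hk Et (E22 & E8 & Ena & Hx).
      unfold J; rewrite !ns_setn by lia; cbn [na ra rs so setn].
      rewrite !nowr_run, nowrna_run by reflexivity; repeat split; auto.
      assert (Hbody : so (run inp W body t) =
        upd (so t) k (if (ns s 22 <=? na s 4 k) && negb (k =? ns s 8) then 1 else 0)).
      { rewrite <- E22, <- E8, <- Ena; clear Hx E22 E8 Ena Hk; subst k.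
        destruct t as [N NA RR RA O].
        unfold body, eqtest; cbn [ns na rs ra so] in *; sx.
        destruct (Nat.leb_spec (N 22) (NA 4 (N 10))); iftest; try lia; sx; auto.
        destruct (Nat.eqb_spec (N 10) (N 8)); iftest; try lia; sx; auto. }
      rewrite Hbody; intros x Hxk.
      destruct (Nat.eq_dec x k) as [->|]; [apply upd_eq|].
      rewrite upd_neq; auto; apply Hx; lia. }
  rewrite (HP 0) in HJ by lia; apply HJ.
Qed.

(** The output always holds a feasible set whose weight is real register 0. Optimality is kept
    apart, as lower bounds on this register. *)
Definition recorded (n : nat) (E : list (nat * nat)) (w : nat -> R) (s : state) : Prop :=
  exists l, shelling_from n E [] l /\ (forall v, In v l <-> v < n /\ so s v <> 0) /\
    weight w l = rs s 0.

Lemma record_run n m inK E inp w s i0 :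
  is_split_graph n inK E -> i0 <= n -> (i0 < n -> inK i0 = false) ->
  par n m s -> ns s 8 = i0 -> recorded n E w s ->
  arc_closed n inK E i0 (fun x => ns s 22 <=? na s 4 x) ->
  rs s 1 = wsum (S n) (wt n w i0) (fun x => ns s 22 <=? na s 4 x) ->
  let t := run inp w cmd_record s in
  recorded n E w t /\ (rs s 0 <= rs t 0)%R /\ (rs s 1 <= rs t 0)%R.
Proof.
  intros HG Hi HiI HP E8 HB HC Hw; cbv zeta; unfold cmd_record.
  set (c := Seq (Do (ORZero 2)) _).
  change (run inp w (IfR 1 0 Skip c) s) with
    (if Rle_dec (rs s 1) (rs s 0) then s else run inp w c s).
  destruct Rle_dec as [L|L]; [split; auto; split; lra|].
  assert (E0 : rs (run inp w c s) 0 = rs s 1).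
  { unfold c; rewrite !run_seq, nowrrs_run by reflexivity.
    change (rs s 1 + 0 = rs s 1)%R; ring. }
  rewrite E0; split; [|lra].
  destruct (shelling_of_closed n inK E w i0 _ HG Hi HiI HC) as (l & Hl & HF & Hwl).
  exists l; split; auto; split; [|congruence].
  intros v; rewrite HF; clear - E8 HP.
  assert (Hso : v < n -> so (run inp w c s) v =
    if (ns s 22 <=? na s 4 v) && negb (v =? ns s 8) then 1 else 0).
  { intros Hv; unfold c; rewrite !run_seq.
    set (s2 := run inp w (Do (ORAdd 0 1 2)) _).
    now rewrite (write_run n m inp w s2). }
  subst i0; split.
  - intros (Hv & Hne & Hs); split; auto; rewrite Hso, Hs; auto.
    destruct (Nat.eqb_spec v (ns s 8)); [tauto|discriminate].
  - intros (Hv & Hs); rewrite Hso in Hs; auto; split; auto.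
    destruct (ns s 22 <=? na s 4 v); [|tauto].
    destruct (Nat.eqb_spec v (ns s 8)); [tauto|auto].
Qed.

(** The best weight never decreases, so the bound obtained here for one [i0] survives all later
    iterations. *)
Lemma solve_run n m inK E inp w s i0 :
  is_split_graph n inK E -> i0 <= n -> (i0 < n -> inK i0 = false) ->
  base n m inK E i0 s -> recorded n E w s ->
  let t := run inp w cmd_solve s in
  recorded n E w t /\ (rs s 0 <= rs t 0)%R /\
  forall C, arc_closed n inK E i0 C -> (wsum (S n) (wt n w i0) C <= rs t 0)%R.
Proof.
  intros HG Hi HiI HB HR; cbv zeta; unfold cmd_solve; rewrite !run_seq.
  set (s1 := run inp w cmd_arcs s); set (s2 := run inp w cmd_nodes s1).
  set (s3 := run inp w cmd_passes s2); set (s4 := run inp w cmd_gap s3).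
  set (s5 := run inp w cmd_sum s4).
  assert (HB1 : base n m inK E i0 s1) by (now apply base_run).
  assert (HB2 : base n m inK E i0 s2) by (now apply base_run).
  assert (HB3 : base n m inK E i0 s3) by (now apply base_run).
  assert (HB4 : base n m inK E i0 s4) by (now apply base_run).
  assert (HB5 : base n m inK E i0 s5) by (now apply base_run).
  pose proof (arcs_run n m inK E i0 inp w s HB Hi) as Hcell; fold s1 in Hcell.
  set (A := na s1 3) in *.
  (* The array holds arbitrary nonzero numbers for arcs; only their vanishing is compared with
     [arcb]. *)
  assert (HAC : forall C, succ_closed (n + 1) A C <-> arc_closed n inK E i0 C).
  { intros C; split; intros HC u v Hu Hv Ha; apply HC; auto; try lia.
    - destruct (Hcell u v ltac:(lia) ltac:(lia)) as [Hc _].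
      rewrite Ha in Hc; apply Nat.eqb_neq in Hc; exact Hc.
    - destruct (Hcell u v Hu Hv) as [Hc _]; apply Nat.eqb_neq in Ha; fold A in Hc.
      rewrite Ha in Hc; destruct arcb; auto; discriminate. }
  pose proof (nodes_run n m inK E i0 inp w s1 HB1) as Hnodes; fold s2 in Hnodes;
    cbv zeta in Hnodes.
  assert (HI2 : inv (n + 1) A (wt n w i0) (abs s2)).
  { apply init_inv; unfold abs; cbn [pF pE pD].
    - intros u v Hu Hv; unfold s2; rewrite nowrra_run by reflexivity.
      now destruct (Hcell u v Hu Hv).
    - intros x Hx; now apply Hnodes.
    - intros x Hx; now apply Hnodes. }
  assert (HC2 : ctx n m A s2).
  { split; [apply HB2|split; [apply HB2|]].
    unfold s2; now rewrite nowrna_run by reflexivity. }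
  pose proof (passes_run n m A inp w s2 HC2) as E3; fold s3 in E3.
  assert (HI3 : inv (n + 1) A (wt n w i0) (abs s3)) by (rewrite E3; now apply passes_inv).
  assert (HQ : forall x, x < n + 1 -> ~ active (n + 1) (abs s3) x).
  { rewrite E3; apply (passes_quiet _ _ (wt n w i0)); auto.
    replace (n + 1 + 2) with (n + 3) by lia; lia. }
  destruct (gap_run n m inp w s3 (proj1 HB3)) as [Hg1 Hg2]; fold s4 in Hg1, Hg2.
  change (na s3 4) with (pD (abs s3)) in Hg2.
  set (g := ns s4 22) in *.
  pose proof (gap_closed _ _ _ _ g HI3 Hg2) as Hcl.
  assert (E45 : na s5 4 = pD (abs s3)).
  { unfold s5, s4; now rewrite !nowrna_run by reflexivity. }
  assert (E5g : ns s5 22 = g) by (unfold s5; now rewrite nowr_run by reflexivity).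
  assert (Hw : rs s5 1 = wsum (S n) (wt n w i0) (fun x => g <=? pD (abs s3) x)).
  { unfold s5; rewrite (sum_run n m) by apply HB4; fold g.
    unfold s4, s3; rewrite nowrna_run, !nowrra_run by reflexivity.
    rewrite Nat.add_1_r; apply rsum_ext; intros x Hx.
    destruct (Hnodes x ltac:(lia)) as (_ & -> & _); reflexivity. }
  assert (HR5 : recorded n E w s5).
  { unfold recorded in *; unfold s5, s4, s3, s2, s1.
    rewrite !nowrso_run, !nowrrs_run by reflexivity; exact HR. }
  destruct (record_run n m inK E inp w s5 i0) as (H1 & H2 & H3); auto; try apply HB5.
  - rewrite E45, E5g; now apply HAC.
  - rewrite E45, E5g; exact Hw.
  - split; auto; split.
    + replace (rs s 0) with (rs s5 0); auto.
      unfold s5, s4, s3, s2, s1; now rewrite !nowrrs_run by reflexivity.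
    + intros C HC; apply HAC in HC.
      pose proof (gap_optimal _ _ _ _ g C HI3 HQ Hg1 Hg2 HC) as Hle.
      rewrite Nat.add_1_r in Hle; lra.
Qed.

(** * Reading the input *)

Lemma rows_run n m inp W s : par n m s ->
  rows n (run inp W cmd_rows s).
Proof.
  intros HP; unfold cmd_rows; rewrite run_seq; set (s1 := run inp W (Do _) s).
  set (body := Seq (Do (OSt 0 9 15)) _).
  assert (HP1 : par n m s1) by (now apply par_run).
  set (J := fun k t => par n m t /\ ns t 15 = k * (n + 1) /\
    forall x, x < k -> na t 0 x = x * (n + 1)).
  assert (HJ : J (ns s1 2) (run inp W (For 9 2 body) s1)).
  { apply for_rule.
    - split; [apply par_setn; auto; lia|split; [reflexivity|intros; lia]].
    - intros k t Hk Et (HPt & E15 & Hx).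
      split; [apply par_setn; [lia|]; now apply par_run|].
      assert (Hb : ns (run inp W body t) 15 = ns t 15 + ns t 2 /\
        na (run inp W body t) 0 = upd (na t 0) (ns t 9) (ns t 15)) by (split; reflexivity).
      destruct Hb as [Hb1 Hb2].
      rewrite ns_setn, Hb1, E15, (HPt 2) by lia; cbn [na setn]; rewrite Hb2, Et, E15.
      change (params n m 2) with (n + 1); split; [lia|].
      intros x Hxk; destruct (Nat.eq_dec x k) as [->|]; [apply upd_eq|].
      rewrite upd_neq by auto; apply Hx; lia. }
  rewrite (HP1 2) in HJ by lia; destruct HJ as (_ & _ & HJ); exact HJ.
Qed.

Lemma encode_clique n inK E x : x < n ->
  encode_input n inK E (x + 1 + 1) = if inK x then 1 else 0.
Proof.
  intros Hx; unfold encode_input.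
  destruct (Nat.eqb_spec (x + 1 + 1) 0); [lia|].
  destruct (Nat.eqb_spec (x + 1 + 1) 1); [lia|].
  destruct (Nat.ltb_spec (x + 1 + 1) (2 + n)); [|lia].
  replace (x + 1 + 1 - 2) with x by lia; reflexivity.
Qed.

(** The tape addresses are written as the code forms them, by additions only. *)
Lemma encode_edge n inK E k a b : nth_error E k = Some (a, b) ->
  encode_input n inK E (k + k + (n + 2)) = a /\
  encode_input n inK E (k + k + (n + 2) + 1) = b.
Proof.
  intros Hk; unfold encode_input; split.
  - destruct (Nat.eqb_spec (k + k + (n + 2)) 0); [lia|].
    destruct (Nat.eqb_spec (k + k + (n + 2)) 1); [lia|].
    destruct (Nat.ltb_spec (k + k + (n + 2)) (2 + n)); [lia|].
    replace (k + k + (n + 2) - (2 + n)) with (k * 2) by lia; cbv zeta.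
    rewrite Nat.div_mul, Nat.Div0.mod_mul, Hk by lia; reflexivity.
  - destruct (Nat.eqb_spec (k + k + (n + 2) + 1) 0); [lia|].
    destruct (Nat.eqb_spec (k + k + (n + 2) + 1) 1); [lia|].
    destruct (Nat.ltb_spec (k + k + (n + 2) + 1) (2 + n)); [lia|].
    replace (k + k + (n + 2) + 1 - (2 + n)) with (1 + k * 2) by lia; cbv zeta.
    rewrite Nat.div_add, Nat.Div0.mod_add by lia; cbn [Nat.div Nat.divmod fst Nat.add].
    rewrite Hk; reflexivity.
Qed.

Lemma clique_run n m inK E W s : par n m s -> na s 1 = (fun _ => 0) ->
  forall x, x < n + 1 ->
  (na (run (encode_input n inK E) W cmd_clique s) 1 x =? 0) = negb ((x <? n) && inK x).
Proof.
  intros HP E1; unfold cmd_clique; set (body := Seq (Do (OAdd 15 10 4)) _); set (inp := encode_input n inK E).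
  set (J := fun k t => par n m t /\ forall x,
    na t 1 x = if (x <? k) && inK x then 1 else 0).
  assert (HJ : J (ns s 0) (run inp W (For 10 0 body) s)).
  { apply for_rule.
    - split; [apply par_setn; auto; lia|]; intros x; cbn [na setn]; now rewrite E1.
    - rewrite (HP 0) by lia; intros k t Hk Et (HPt & Hx); change (params n m 0) with n in Hk.
      split; [apply par_setn; [lia|]; now apply par_run|].
      assert (Hb : na (run inp W body t) 1 =
        upd (na t 1) (ns t 10) (inp (ns t 10 + ns t 4 + ns t 4))) by reflexivity.
      cbn [na setn]; rewrite Hb, Et, (HPt 4) by lia; change (params n m 4) with 1.
      unfold inp; rewrite encode_clique by auto; intros x.
      destruct (Nat.eq_dec x k) as [->|Hne].
      + rewrite upd_eq; destruct (Nat.ltb_spec k (S k)); [reflexivity|lia].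
      + rewrite upd_neq, Hx by auto.
        destruct (Nat.ltb_spec x k), (Nat.ltb_spec x (S k)); try lia; reflexivity. }
  rewrite (HP 0) in HJ by lia; destruct HJ as [_ HJ]; intros x Hx.
  rewrite HJ; change (params n m 0) with n; destruct andb; reflexivity.
Qed.

Lemma firstn_S_nth_error {T : Type} (l : list T) k a :
  nth_error l k = Some a -> firstn (S k) l = firstn k l ++ [a].
Proof.
  revert l; induction k; intros [|x l]; simpl; try discriminate.
  - now intros [= ->].
  - intros H; f_equal; now apply IHk.
Qed.

(** After [k] iterations the matrix represents the prefix [firstn k E]. Edge ends are below [n], so
    the two writes per edge hit exactly the intended cells. *)
Lemma edges_run n inK E W s : is_split_graph n inK E -> par n (length E) s ->
  rows n s -> na s 2 = (fun _ => 0) -> forall u v, u < n + 1 -> v < n + 1 ->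
  (na (run (encode_input n inK E) W cmd_edges s) 2 (u * (n + 1) + v) =? 0) =
  negb (adjb E u v).
Proof.
  intros (HE & _) HP HR E2; unfold cmd_edges; set (body := Seq (Do (OAdd 15 23 23)) _).
  set (inp := encode_input n inK E).
  set (J := fun k t => par n (length E) t /\ rows n t /\ forall u v, u < n + 1 -> v < n + 1 ->
    (na t 2 (u * (n + 1) + v) =? 0) = negb (adjb (firstn k E) u v)).
  assert (HJ : J (ns s 1) (run inp W (For 23 1 body) s)).
  { apply for_rule.
    - split; [apply par_setn; auto; lia|split; auto]; intros; cbn [na setn]; now rewrite E2.
    - rewrite (HP 1) by lia; change (params n (length E) 1) with (length E).
      intros k t Hk Et (HPt & HRt & Hx).
      split; [apply par_setn; [lia|]; now apply par_run|split].
      { unfold rows; cbn [na setn]; now rewrite nowrna_run. }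
      destruct (nth_error E k) as [[a b]|] eqn:Hn; [|apply nth_error_None in Hn; lia].
      destruct (encode_edge n inK E k a b Hn) as [Ea Eb]; fold inp in Ea, Eb.
      destruct (HE a b) as (Ha & Hb & _); [now apply nth_error_In with k|].
      assert (Hbody : na (run inp W body t) 2 =
        upd (upd (na t 2) (a * (n + 1) + b) 1) (b * (n + 1) + a) 1).
      { pose proof (HPt 6 ltac:(lia)) as H6; pose proof (HPt 4 ltac:(lia)) as H4.
        unfold params in H4, H6; cbn [nth] in H4, H6.
        pose proof (HRt a ltac:(lia)) as Ra; pose proof (HRt b ltac:(lia)) as Rb.
        clear Hx HPt HRt; destruct t as [N NA RR RA O]; cbn [ns na] in *.
        unfold body; sx; cbn [na].
        cbn [upd Nat.eqb]. rewrite Et, H6, H4, Ea, Eb, Ra, Rb; reflexivity. }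
      cbn [na setn]; rewrite Hbody; intros u v Hu Hv.
      rewrite !upd_idx by lia.
      rewrite (firstn_S_nth_error E k (a, b) Hn); unfold adjb in *.
      rewrite existsb_app; cbn [existsb fst snd]; rewrite orb_false_r, negb_orb, <- Hx by auto.
      rewrite (Nat.eqb_sym a u), (Nat.eqb_sym b v), (Nat.eqb_sym a v), (Nat.eqb_sym b u).
      destruct (u =? b), (v =? a), (u =? a), (v =? b); cbn [andb orb negb Nat.eqb];
        rewrite ?andb_true_r, ?andb_false_r; reflexivity. }
  rewrite (HP 1) in HJ by lia; change (params n (length E) 1) with (length E) in HJ.
  destruct HJ as (_ & _ & HJ); rewrite firstn_all in HJ; exact HJ.
Qed.

Lemma last_row_run n m inp W s : par n m s -> rows n s ->
  let t := run inp W cmd_last_row s in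
  (forall u v, u < n -> v < n + 1 -> na t 2 (u * (n + 1) + v) = na s 2 (u * (n + 1) + v)) /\
  forall v, v < n + 1 -> na t 2 (n * (n + 1) + v) <> 0.
Proof.
  intros HP HR; cbv zeta; unfold cmd_last_row; rewrite run_seq; set (s1 := run inp W (Do _) s).
  assert (HP1 : par n m s1) by (now apply par_run).
  assert (E11 : ns s1 11 = n * (n + 1)).
  { change (ns s1 11) with (na s 0 (ns s 0)); rewrite (HP 0) by lia; apply HR.
    change (params n m 0) with n; lia. }
  change (na s 2) with (na s1 2); clearbody s1.
  set (body := Seq (Do (OAdd 12 11 10)) _).
  set (J := fun k t => par n m t /\ ns t 11 = n * (n + 1) /\
    (forall u v, u < n -> v < n + 1 -> na t 2 (u * (n + 1) + v) = na s1 2 (u * (n + 1) + v)) /\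
    forall v, v < k -> na t 2 (n * (n + 1) + v) <> 0).
  assert (HJ : J (ns s1 2) (run inp W (For 10 2 body) s1)).
  { apply for_rule.
    - split; [apply par_setn; auto; lia|split; [rewrite ns_setn; auto|split; auto]].
      intros; lia.
    - rewrite (HP1 2) by lia; change (params n m 2) with (n + 1).
      intros k t Hk Et (HPt & Et11 & Hu & Hv).
      split; [apply par_setn; [lia|]; now apply par_run|].
      split; [rewrite ns_setn by lia; now rewrite nowr_run|].
      assert (Hb : na (run inp W body t) 2 =
        upd (na t 2) (ns t 11 + ns t 10) (ns t 4)) by reflexivity.
      cbn [na setn]; rewrite Hb, Et11, Et, (HPt 4) by lia; split.
      + intros u v Hun Hvn; rewrite upd_idx by auto.
        destruct (Nat.eqb_spec u n); [lia|]; now apply Hu.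
      + intros v Hvk; rewrite upd_idx by lia; rewrite Nat.eqb_refl.
        destruct (Nat.eqb_spec v k); cbn [andb]; [discriminate|apply Hv; lia]. }
  rewrite (HP1 2) in HJ by lia; change (params n m 2) with (n + 1) in HJ.
  destruct HJ as (_ & _ & H); exact H.
Qed.

Lemma setup_run n inK E W s : is_split_graph n inK E -> par n (length E) s ->
  na s = (fun _ _ => 0) ->
  data n inK E (run (encode_input n inK E) W cmd_setup s).
Proof.
  intros HG HP Hz; set (inp := encode_input n inK E).
  unfold cmd_setup; rewrite !run_seq; set (s1 := run inp W cmd_rows s).
  set (s2 := run inp W cmd_clique s1); set (s3 := run inp W cmd_edges s2).
  set (s4 := run inp W cmd_last_row s3).
  assert (HP1 : par n (length E) s1) by (now apply par_run).
  assert (HP2 : par n (length E) s2) by (now apply par_run).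
  assert (HP3 : par n (length E) s3) by (now apply par_run).
  assert (R1 : rows n s1) by (now apply (rows_run n (length E))).
  assert (R2 : rows n s2) by (unfold rows, s2; now rewrite nowrna_run).
  assert (R3 : rows n s3) by (unfold rows, s3; now rewrite nowrna_run).
  destruct (last_row_run n (length E) inp W s3 HP3 R3) as [L1 L2]; fold s4 in L1, L2.
  split; [unfold rows, s4; now rewrite nowrna_run|split; [|split]]; auto.
  - intros x Hx; unfold s4, s3; rewrite !nowrna_run by reflexivity.
    apply (clique_run n (length E)); auto.
    unfold s1; now rewrite nowrna_run, Hz.
  - intros u v Hu Hv; rewrite L1 by auto.
    apply (edges_run n inK E W s2); auto; try lia.
    unfold s2, s1; now rewrite !nowrna_run, Hz.
Qed.

(** * Optimality over all exceptions and the final program *)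

Lemma main_run n inK E w s : is_split_graph n inK E -> par n (length E) s ->
  na s = (fun _ _ => 0) -> so s = (fun _ => 0) -> rs s = (fun _ => 0%R) ->
  max_weight_feasible n E w
    (fun v => v < n /\ so (run (encode_input n inK E) w cmd_main s) v <> 0).
Proof.
  intros HG HP Hz Ho Hr; set (inp := encode_input n inK E).
  unfold cmd_main; rewrite run_seq; set (s1 := run inp w cmd_setup s).
  assert (HP1 : par n (length E) s1) by (now apply par_run).
  pose proof (setup_run n inK E w s HG HP Hz) as HD; fold inp s1 in HD.
  (* The zeroed memory records the empty set with weight 0. *)
  assert (HR1 : recorded n E w s1).
  { exists []; split; [exact I|split].
    - intros v; unfold s1; rewrite nowrso_run, Ho by reflexivity; simpl; tauto.
    - unfold s1; rewrite nowrrs_run, Hr by reflexivity; reflexivity. }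
  set (body := Seq (Do (OLd 15 1 8)) _).
  set (J := fun k t => par n (length E) t /\ data n inK E t /\ recorded n E w t /\
    forall i0 C, i0 < k -> (i0 < n -> inK i0 = false) -> arc_closed n inK E i0 C ->
      (wsum (S n) (wt n w i0) C <= rs t 0)%R).
  assert (HJ : J (ns s1 2) (run inp w (For 8 2 body) s1)).
  { apply for_rule.
    - split; [apply par_setn; auto|split; [exact HD|split; [exact HR1|intros; lia]]].
    - rewrite (HP1 2) by lia; change (params n (length E) 2) with (n + 1).
      intros k t Hk Et (HPt & HDt & HRt & Hx).
      assert (HBt : base n (length E) inK E k t) by (split; [auto|split; auto]).
      assert (HBb : base n (length E) inK E k (run inp w body t)) by (now apply base_run).
      split; [apply par_setn; [lia|]; apply HBb|split; [apply HBb|]].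
      unfold body; rewrite run_seq; set (t1 := run inp w (Do (OLd 15 1 8)) t).
      assert (HBt1 : base n (length E) inK E k t1) by (now apply base_run).
      change (run inp w (IfZ 15 cmd_solve Skip) t1) with
        (if na t 1 (ns t 8) =? 0 then run inp w cmd_solve t1 else t1).
      assert (HRt1 : recorded n E w t1) by exact HRt.
      rewrite Et, (proj1 (proj2 HDt)) by lia.
      destruct ((k <? n) && inK k) eqn:EK; cbn [negb].
      (* A clique vertex is skipped; the bound demanded for it is vacuous, as exceptions lie in
         [I]. *)
      + split; [exact HRt|]; intros i0 C Hi HiI HC.
        destruct (Nat.eq_dec i0 k) as [->|]; [|apply Hx; auto; lia].
        apply andb_true_iff in EK as [L EK]; apply Nat.ltb_lt in L.
        rewrite (HiI L) in EK; discriminate.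
      + destruct (solve_run n (length E) inK E inp w t1 k) as (S1 & S2 & S3); auto; [lia| |].
        { intros L; apply Nat.ltb_lt in L; now rewrite L in EK. }
        split; [exact S1|]; intros i0 C Hi HiI HC; cbn [rs setn].
        destruct (Nat.eq_dec i0 k) as [->|]; [now apply S3|].
        apply Rle_trans with (rs t1 0); auto; apply Hx; auto; lia. }
  rewrite (HP1 2) in HJ by lia; change (params n (length E) 2) with (n + 1) in HJ.
  destruct HJ as (_ & _ & (l & Hl & HF & Hw) & Hopt).
  exists l; split; auto; split; auto.
  (* Every competing shelling weighs as much as a closed set for some exception, and all of these
     are bounded. *)
  intros l' Hl'; destruct (closed_of_shelling n inK E w l' HG Hl') as (i0 & C & Hi & HiI & HC & ->).
  rewrite Hw; apply Hopt; auto; lia.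
Qed.

(** The prologue fills the read-only registers and hence stands outside the for-language. Its six
    instructions place the compiled code at address 6; registers 5 and 7 are 0 from the start. *)
Definition ram : program :=
  [NIn 0 0; NConst 4 1; NIn 1 4; NAdd 2 0 4; NAdd 6 2 4; NAdd 3 6 4] ++
  compile 6 cmd_main ++ [Halt].

Theorem mainTheorem13 :
  exists (p : program) (C k : nat),
    forall (n : nat) (inK : nat -> bool) (E : list (nat * nat)) (w : nat -> R),
      is_split_graph n inK E ->
      exists c : config,
        exec p (encode_input n inK E) w (C * (n + length E + 1) ^ k) init_config = Some c /\
        max_weight_feasible n E w (output_set n c).
Proof.
  (* All loop bounds are at most [3 * (n + length E + 1)], which yields the power of 3. The 8 covers
     the prologue and the strict fuel bound. *)
  exists ram, (csize cmd_main * 3 ^ depth cmd_main + 8), (depth cmd_main).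
  intros n inK E w HG; set (inp := encode_input n inK E); set (m := length E).
  set (s0 := mkState (params n m) (fun _ _ => 0) (fun _ => 0%R) (fun _ _ => 0%R) (fun _ => 0)).
  set (c0 := mkConfig 6 (upd (upd (upd (upd (upd (upd (fun _ => 0) 0 n) 4 1) 1 m) 2 (n + 1))
    6 (n + 1 + 1)) 3 (n + 1 + 1 + 1)) (fun _ => 0%R) (fun _ => 0)).
  assert (H6 : nsteps ram inp w 6 init_config = Some c0) by reflexivity.
  assert (Hs : sim s0 c0).
  { split; auto; simpl.
    - intros x Hx; unfold params.
      do 8 (destruct x as [|x]; [simpl; lia|]).
      rewrite nth_overflow by (simpl; lia); rewrite !upd_neq by lia; reflexivity. }
  assert (Hwf : wf cmd_main = true) by reflexivity.
  assert (Hcode : code_at ram (pc c0) (compile (pc c0) cmd_main ++ [Halt])).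
  { pose proof (code_at_self [NIn 0 0; NConst 4 1; NIn 1 4; NAdd 2 0 4; NAdd 6 2 4; NAdd 3 6 4]
      (compile 6 cmd_main ++ [Halt]) []) as H; rewrite app_nil_r in H; exact H. }
  apply code_at_app in Hcode as [Hcode [Hhalt _]]; rewrite compile_length in Hhalt.
  destruct (compile_correct ram inp w (params n m) cmd_main s0 c0 Hwf Hcode Hs)
    as (t & c & Ht & Hn & Hpc & Hsim); auto.
  exists c; split.
  - apply exec_nsteps with (6 + t).
    + eapply nsteps_add; eauto.
    + unfold step; rewrite Hpc, Hhalt; reflexivity.
    + assert (Hc : cost (params n m) cmd_main <=
        csize cmd_main * (3 * (n + m + 1)) ^ depth cmd_main).
      { apply cost_le; auto; [lia|]; intros q Hq; unfold params.
        do 8 (destruct q as [|q]; [simpl; lia|]); lia. }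
      rewrite Nat.pow_mul_l in Hc.
      assert (Hp : 1 <= (n + m + 1) ^ depth cmd_main).
      { apply Nat.neq_0_lt_0, Nat.pow_nonzero; lia. }
      fold m; generalize dependent (csize cmd_main); intros z Hz.
      revert Hz Hp; generalize ((n + m + 1) ^ depth cmd_main), (3 ^ depth cmd_main).
      intros; nia.
  - assert (HF := main_run n inK E w s0 HG ltac:(intros q Hq; reflexivity)
      eq_refl eq_refl eq_refl); fold inp in HF.
    destruct HF as (l & Hl & HF & Hmax); exists l; split; auto; split; auto.
    intros v; rewrite HF; unfold output_set.
    rewrite (sim_so _ _ Hsim); reflexivity.
Qed.
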